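(* Let $X$ be a connected CW-complex with finite $1$-skeleton, let $H=H_1(X,\mathbb{Z})$, and let $A$ be a quotient of $H$. Set $n=\operatorname{rank} H$ and $r=\operatorname{rank} A$. Then there is a bijection $$\Gamma(H,A)\ \longleftrightarrow\ \mathrm{GL}_n(\mathbb{Z})\times_{\mathrm{P}}\Gamma,$$ where $\Gamma$ is the finite set $\Gamma(H/\overline{A},A/\overline{A})$, $\mathrm{P}\subset \mathrm{GL}_n(\mathbb{Z})$ is the parabolic subgroup with $\mathrm{GL}_n(\mathbb{Z})/\mathrm{P}=\mathrm{Gr}_{n-r}(\mathbb{Z}^n)$, and $\mathrm{GL}_n(\mathbb{Z})\times_{\mathrm{P}}\Gamma$ is the twisted product of $\mathrm{GL}_n(\mathbb{Z})$ and $\Gamma$ under the natural action of $\mathrm{P}$ on the two sets.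
   Context: For finitely generated abelian groups $K,B$, $\operatorname{Epi}(K,B)$ is the set of epimorphisms $K\twoheadrightarrow B$ and $\Gamma(K,B)=\operatorname{Epi}(K,B)/\operatorname{Aut}(B)$, where $\operatorname{Aut}(B)$ acts by composition. $\overline{H}=H/\operatorname{Tors}(H)$ and $\overline{A}=A/\operatorname{Tors}(A)$; identify $\overline{H}=\mathbb{Z}^n$, $\overline{A}=\mathbb{Z}^r$, and fix splittings $\overline{H}\hookrightarrow H$, $\overline{A}\hookrightarrow A$. Choosing also a splitting $\overline{A}\hookrightarrow H$ (with image in $\overline{H}$) of an epimorphism $H\twoheadrightarrow\overline{A}$, one has $H/\overline{A}\cong \mathbb{Z}^{n-r}\oplus\operatorname{Tors}(H)$ and $A/\overline{A}\cong\operatorname{Tors}(A)$. So an element of $\Gamma=\Gamma(H/\overline{A},A/\overline{A})$ is a class $[\gamma_1,\gamma_2]$ of epimorphisms $(\gamma_1,\gamma_2)\colon \mathbb{Z}^{n-r}\oplus\operatorname{Tors}(H)\twoheadrightarrow\operatorname{Tors}(A)$ modulo $\operatorname{Aut}(\operatorname{Tors}(A))$. $\mathrm{Gr}_{n-r}(\mathbb{Z}^n)$ is the set of primitive (direct summand) subgroups of rank $n-r$ of $\mathbb{Z}^n$. $\mathrm{P}$ is the group of matrices $Q=\begin{pmatrix} Q_1&Q_2\\0&Q_3\end{pmatrix}\in \mathrm{GL}_n(\mathbb{Z})$ with $Q_1$ of size $(n-r)\times(n-r)$. It acts on $\mathrm{GL}_n(\mathbb{Z})$ by right multiplication and on $\Gamma$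 by $Q\cdot[\gamma_1,\gamma_2]=[\gamma_1Q_1^{-1},\gamma_2]$. The twisted product $\mathrm{GL}_n(\mathbb{Z})\times_{\mathrm{P}}\Gamma$ is the quotient of $\mathrm{GL}_n(\mathbb{Z})\times\Gamma$ by the relation $(MQ,\gamma)\sim(M,Q\cdot\gamma)$, $Q\in \mathrm{P}$. *)

(* Defs.v *)
From HB Require Import structures.
From mathcomp Require Import all_boot all_order all_algebra.
From mathcomp Require Import all_classical all_reals all_analysis.
From mathcomp Require Import freeg.
Import numFieldNormedType.Exports.

Set Implicit Arguments.
Unset Strict Implicit.
Unset Printing Implicit Defensive.

Import Order.TTheory GRing.Theory Num.Theory.
Local Open Scope classical_set_scope.
Local Open Scope ring_scope.

(* The set of R-classes of D; only used for R an equivalence relation on D. *)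
Definition classes (T : Type) (D : set T) (R : T -> T -> Prop) : set (set T) :=
  [set [set y | D y /\ R x y] | x in D].

Definition subgrp (V : zmodType) (S : zmodClosed V) : Type := {x : V | x \in S}.

Section Subgroup.
Variables (V : zmodType) (S : zmodClosed V).
HB.instance Definition _ := SubChoice.copy (subgrp S) {x : V | x \in S}.
HB.instance Definition _ := [SubChoice_isSubZmodule of subgrp S by <:].
End Subgroup.

Definition quotgrp (V : zmodType) (S : zmodClosed V) : zmodType :=
  Quotient.quot S.

Definition quotmap (V : zmodType) (S : zmodClosed V) :
    {additive V -> quotgrp S} := (\pi_(Quotient.quot S))%qT.

Section KernelImage.
Variables (V W : zmodType) (f : {additive V -> W}).

Definition ker_pred : {pred V} := fun x => f x == 0.

Lemma ker_pred_zmod_closed : zmod_closed ker_pred.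
Proof.
split=> [|x y]; rewrite !unfold_in ?raddf0 // => /eqP fx /eqP fy.
by rewrite raddfB fx fy subrr.
Qed.

HB.instance Definition _ := GRing.isZmodClosed.Build V ker_pred
  ker_pred_zmod_closed.

Definition im_pred : {pred W} := fun y => `[< exists x, f x = y >].

Lemma im_pred_zmod_closed : zmod_closed im_pred.
Proof.
split=> [|x y]; rewrite !unfold_in.
  by apply/asboolP; exists 0; exact: raddf0.
move=> /asboolP[a <-] /asboolP[b <-]; apply/asboolP.
by exists (a - b); rewrite raddfB.
Qed.

HB.instance Definition _ := GRing.isZmodClosed.Build W im_pred
  im_pred_zmod_closed.

End KernelImage.

Section Torsion.
Variable K : zmodType.

Definition torsion : {pred K} :=
  fun x => `[< exists2 m : nat, (0 < m)%N & x *+ m = 0 >].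

Lemma torsion_zmod_closed : zmod_closed torsion.
Proof.
split=> [|x y]; rewrite !unfold_in.
  by apply/asboolP; exists 1%N; rewrite ?mul0rn.
move=> /asboolP[a a0 xa] /asboolP[b b0 yb]; apply/asboolP.
exists (a * b)%N; first by rewrite muln_gt0 a0.
by rewrite mulrnBl mulrnA xa mul0rn mulnC mulrnA yb mul0rn subrr.
Qed.

HB.instance Definition _ := GRing.isZmodClosed.Build K torsion
  torsion_zmod_closed.

Definition Tors : zmodType := subgrp torsion.

End Torsion.

Arguments torsion : clear implicits.

Definition Zindep (K : zmodType) (m : nat) (v : 'I_m -> K) : Prop :=
  forall c : 'I_m -> int, \sum_i v i *~ c i = 0 -> forall i, c i = 0.

Definition has_rank (K : zmodType) (S : set K) (m : nat) : Prop :=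
  (exists2 v : 'I_m -> K, Zindep v & forall i, S (v i)) /\
  (forall v : 'I_m.+1 -> K, (forall i, S (v i)) -> ~ Zindep v).

(* 0 by convention if K contains arbitrarily large independent families. *)
Definition rank (K : zmodType) : nat := xget 0%N [set m | has_rank [set: K] m].

Definition epi (K B : zmodType) (f : {additive K -> B}) : Prop :=
  forall b, exists k, f k = b.

Definition Epi (K B : zmodType) : set {additive K -> B} := [set f | epi f].
Arguments Epi : clear implicits.

Definition Gamma (K B : zmodType) : set (set {additive K -> B}) :=
  classes (Epi K B)
    (fun f g => exists2 a : {additive B -> B}, bijective a & g =1 a \o f).
Arguments Gamma : clear implicits.

Definition GLZ (n : nat) : set 'M[int]_n := [set M | M \in unitmx].
Arguments GLZ : clear implicits.

Section Parabolic.
Variables n r : nat.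

(* Q1 in Q = [Q1, Q2; 0, Q3]. *)
Definition ulblock (Q : 'M[int]_n) : 'M[int]_(n - r) :=
  mxsub (widen_ord (leq_subr r n)) (widen_ord (leq_subr r n)) Q.

Definition parabolic : set 'M[int]_n :=
  [set Q | GLZ n Q /\
    forall i j : 'I_n, (j < n - r <= i)%N -> Q i j = 0].

Definition GL_mod_parabolic : set (set 'M[int]_n) :=
  [set [set M *m Q | Q in parabolic] | M in GLZ n].

(* Z^(n-r) x 0, the summand whose stabilizer in GL_n(Z) is [parabolic]. *)
Definition std_summand : set 'cV[int]_n :=
  [set v | forall i : 'I_n, (n - r <= i)%N -> v i 0 = 0].

End Parabolic.
Arguments parabolic : clear implicits.
Arguments GL_mod_parabolic : clear implicits.
Arguments std_summand : clear implicits.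

Definition is_subgroup (K : zmodType) (S : set K) : Prop :=
  S 0 /\ forall x y, S x -> S y -> S (x - y).

Definition direct_summand (K : zmodType) (S : set K) : Prop :=
  is_subgroup S /\ exists T : set K, [/\ is_subgroup T,
    S `&` T = [set 0] &
    forall x, exists s t, [/\ S s, T t & x = s + t]].

Definition Gr (m n : nat) : set (set 'cV[int]_n) :=
  [set S | direct_summand S /\ has_rank S m].
Arguments Gr : clear implicits.

(* H/Tors(H) and A/Tors(A) are identified with Z^n and Z^r through the
   surjections [projH] and [projA], whose kernels are the torsion subgroups.
   [quoH] is the resulting identification of Z^(n-r) (+) Tors(H) with the
   quotient of H by the image of [sec]: it is canonical on Tors(H), and maps
   Z^(n-r) into the image of the chosen copy of H/Tors(H). *)
Record splitting (H A : zmodType) (n r : nat) := Splitting {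
  projH : {additive H -> 'cV[int]_n};
  secH : {additive 'cV[int]_n -> H};
  projA : {additive A -> 'cV[int]_r};
  secA : {additive 'cV[int]_r -> A};
  epiHA : {additive H -> 'cV[int]_r};
  sec : {additive 'cV[int]_r -> H};
  quoH : {additive ('cV[int]_(n - r) * Tors H)%type ->
                   quotgrp (im_pred sec)};
  projH_epi : epi projH;
  projH_ker : forall x, projH x = 0 <-> x \in torsion H;
  secHK : cancel secH projH;
  projA_epi : epi projA;
  projA_ker : forall x, projA x = 0 <-> x \in torsion A;
  secAK : cancel secA projA;
  epiHA_epi : epi epiHA;
  secK : cancel sec epiHA;
  sec_sub : forall v, exists u, sec v = secH u;
  quoH_bij : bijective quoH;
  quoH_tors : forall t : Tors H,
    quoH (0, t) = quotmap (im_pred sec) (val t);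
  quoH_free : forall v, exists u,
    quoH (v, 0) = quotmap (im_pred sec) (secH u)
}.

Section Twisted.
Variables (H A : zmodType) (n r : nat) (D : splitting H A n r).

Definition HmodA : zmodType := quotgrp (im_pred (sec D)).
Definition AmodA : zmodType := quotgrp (im_pred (secA D)).

Definition GammaT : set (set {additive HmodA -> AmodA}) := Gamma HmodA AmodA.

(* Q . [g1, g2] = [g1 Q1^-1, g2], where (g1, g2) are the coordinates of
   g : H/A -> A/A under the identification [quoH D]. *)
Definition act (Q : 'M[int]_n) (c : set {additive HmodA -> AmodA}) :
    set {additive HmodA -> AmodA} :=
  [set h : {additive HmodA -> AmodA} | exists2 g, c g & forall v t,
     h (quoH D (v, t)) = g (quoH D (invmx (ulblock r Q) *m v, t))].

(* (M', c') ~ (M, Q . c') whenever M' = M Q: as Q ranges over a group this is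
   already an equivalence relation. *)
Definition twist_rel (x y : 'M[int]_n * set {additive HmodA -> AmodA}) : Prop :=
  exists2 Q, parabolic n r Q & x.1 = y.1 *m Q /\ y.2 = act Q x.2.

Definition twisted_product :
    set (set ('M[int]_n * set {additive HmodA -> AmodA})) :=
  classes (GLZ n `*` GammaT) twist_rel.

End Twisted.
Arguments GammaT {H A n r} D _.
Arguments twisted_product {H A n r} D _.

Section Singular.
Variable R : realType.

Definition std_simplex (k : nat) : set 'rV[R]_k.+1 :=
  [set t | (forall i, 0 <= t 0 i) /\ \sum_i t 0 i = 1].
Arguments std_simplex : clear implicits.

Definition face_vec (k : nat) (i : 'I_k.+2) (t : 'rV[R]_k.+1) : 'rV[R]_k.+2 :=
  \row_j oapp (t 0) 0 (unlift i j).

Lemma face_vec_simplex k i (t : std_simplex k) :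
  face_vec i (set_val t) \in std_simplex k.+1.
Proof.
have [t0 t1] : std_simplex k (set_val t) by exact: set_valP.
rewrite inE; split=> [j|].
  by rewrite mxE; case: unlift => /=.
rewrite (bigD1_ord i) //= mxE unlift_none add0r -t1.
by apply: eq_bigr => j _; rewrite mxE liftK.
Qed.

Definition face k (i : 'I_k.+2) (t : std_simplex k) : std_simplex k.+1 :=
  exist _ (face_vec i (set_val t)) (face_vec_simplex i t).

Lemma face_continuous k (i : 'I_k.+2) : continuous (@face k i).
Proof.
apply: continuous_comp_initial => t.
apply: (@continuous_comp _ _ _ set_val (face_vec i)).
  exact: initial_continuous.
move=> A [P nP sPA].
exists (fun u j => P u (fintype.lift i j)) => [u j|y Py].
  by have := nP u (fintype.lift i j); rewrite mxE liftK /= (ord1 u).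
apply: sPA => u j; rewrite mxE (ord1 u).
case: unliftP => [j0 ->|->]; first exact: Py.
by have /nbhs_singleton := nP 0 i; rewrite mxE unlift_none.
Qed.

HB.instance Definition _ k (i : 'I_k.+2) :=
  isContinuous.Build (std_simplex k) (std_simplex k.+1) (face i)
    (@face_continuous k i).

Variable X : topologicalType.

Definition chains (k : nat) : lmodType int :=
  {freeg (continuousType (std_simplex k) X) / int}.

Definition boundary_simplex k (s : continuousType (std_simplex k.+1) X) :
    chains k :=
  \sum_(i < k.+2) (-1) ^+ i *:
    << (s \o face i : continuousType (std_simplex k) X) >>.

Definition boundary (k : nat) : chains k.+1 -> chains k :=
  fglift (@boundary_simplex k).

HB.instance Definition _ k := GRing.isZmodMorphism.Build (chains k.+1) (chains k)
  (@boundary k) (lift_is_additive (@boundary_simplex k)).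

(* The (k + 1)-cycles. *)
Definition cycles (k : nat) : zmodType := subgrp (ker_pred (@boundary k)).

Definition bounding (k : nat) : {pred cycles k} :=
  fun z => val z \in im_pred (@boundary k.+1).

Lemma bounding_zmod_closed k : zmod_closed (@bounding k).
Proof.
split=> [|x y]; rewrite ![_ \in @bounding k]unfold_in /bounding.
  by rewrite raddf0 rpred0.
by move=> xB yB; rewrite raddfB rpredB.
Qed.

HB.instance Definition _ k := GRing.isZmodClosed.Build (cycles k) (@bounding k)
  (@bounding_zmod_closed k).

(* The singular homology group of X of degree k + 1, over the integers. *)
Definition homologyS (k : nat) : zmodType := quotgrp (@bounding k).

Definition H1 : zmodType := homologyS 0.

End Singular.
Arguments H1 : clear implicits.

Section Disk.
Variables (R : realType) (k : nat).

Definition disk : set 'rV[R]_k := [set x | \sum_i x 0 i ^+ 2 <= 1].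
Definition open_disk : set 'rV[R]_k := [set x | \sum_i x 0 i ^+ 2 < 1].
Definition sphere : set 'rV[R]_k := [set x | \sum_i x 0 i ^+ 2 = 1].

End Disk.
Arguments disk : clear implicits.
Arguments open_disk : clear implicits.
Arguments sphere : clear implicits.

(* A CW structure on X, given by the characteristic maps of its cells. Only the
   values of [cell_map e] on the closed disk matter. *)
Record cw_complex (R : realType) (X : topologicalType) := CWComplex {
  cell : nat -> Type;
  cell_map : forall k, cell k -> 'rV[R]_k -> X;
  open_cell := fun k (e : cell k) => cell_map e @` open_disk R k;
  closed_cell := fun k (e : cell k) => cell_map e @` disk R k;
  cw_hausdorff : hausdorff_space X;
  cell_map_continuous : forall k (e : cell k),
    {within disk R k, continuous (cell_map e)};
  cell_map_inj : forall k (e : cell k), set_inj (open_disk R k) (cell_map e);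
  (* [cell_map e] is a homeomorphism from the open disk onto the open cell *)
  cell_map_open : forall k (e : cell k) (U : set 'rV[R]_k), open U ->
    exists2 V : set X, open V &
      cell_map e @` (open_disk R k `&` U) = open_cell e `&` V;
  cells_disjoint : forall k (e : cell k) k' (e' : cell k') x,
    open_cell e x -> open_cell e' x -> existT cell k e = existT cell k' e';
  cells_cover : forall x, exists k (e : cell k), open_cell e x;
  cw_closure_finite : forall k (e : cell k), exists2 F : set {j & cell j},
    finite_set F /\ (forall c, F c -> (tag c < k)%N) &
    cell_map e @` sphere R k `<=` \bigcup_(c in F) open_cell (tagged c);
  cw_weak : forall S : set X,
    (forall k (e : cell k), closed (S `&` closed_cell e)) -> closed S
}.

Definition finite_1skeleton (R : realType) (X : topologicalType)
    (W : cw_complex R X) : Prop :=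
  finite_set [set c : {k & cell W k} | (tag c <= 1)%N].

(* Main.v *)
From HB Require Import structures.
Require Import Defs.
From mathcomp Require Import all_boot all_order all_algebra.
From mathcomp Require Import all_classical all_reals all_analysis.
From mathcomp Require Import freeg.
Import numFieldNormedType.Exports.
Import Order.TTheory GRing.Theory Num.Theory.
(** A class in [Gamma H A], where [H] and [A] are finitely generated of ranks [n] and
    [r], consists of epimorphisms [f] up to automorphisms of [A]. Composed with the
    projection of [A] to [Z^r], the map [f] is a surjection from [Z^n] to [Z^r]; up
    to automorphisms of [Z^r] it is determined by its kernel, a direct summand of rank
    [n - r], hence by a coset of the parabolic subgroup. In a basis [M] of [Z^n] whose
    first [n - r] members span this kernel, what is left of [f] is its effect [g] on
    these members and on the torsion of [H], with values in the torsion of [A], that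
    is, in [A] modulo the copy of [Z^r]; the torsion component of its effect on the
    other members is removed by an automorphism of [A]. The pair [(M, g)] is unique up
    to the twisted action. This is made precise by [realize], which turns a pair into an epimorphism, by
    [realize_surj] for the existence of a pair, and by [realize_act] and [act_realize]
    for the pairs with equivalent realizations. The normal form of a surjection to
    [Z^r] and the description of the Grassmannian rest on the Smith normal form and on
    the existence of complements (lemmas [surjection_normal_form] and
    [coset_summand_bij]).

    The topological input is that the first homology group is finitely generated
    (lemma [H1_fg]). It is spanned by combinations of edges, for the following reason.
    Let [phi] be a homomorphism on singular 1-chains that vanishes on boundaries and on
    edges. On a finite subcomplex it has a potential: a function [g] on points such
    that the value of [phi] on a path is the difference of the values of [g] at the
    endpoints. The potential is extended over one cell at a time. In the disk that
    parametrizes the cell there is a potential, the disk being convex, and it agrees on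
    the sphere with the given one up to a constant (lemma [sphere_potential]): in
    dimension at least 2 because the sphere is path connected, in dimension 1 because
    [phi] vanishes on the edge. For a path that runs in and out of the cell the equation
    is local in the parameter (lemma [path_class_local]), and near a point outside the
    open cell the path can be pushed radially out of the cell (lemma
    [extension_potential]). As a singular 1-chain meets only finitely many cells, [phi]
    factors through the boundary on the simplices of a cycle, so it vanishes on the
    cycle (lemma [phi_cycle]). Hence all cycles are in the sum of the boundaries and the
    span of the edges. *)

Set Implicit Arguments.
Unset Strict Implicit.
Unset Printing Implicit Defensive.
Local Open Scope classical_set_scope.
Local Open Scope ring_scope.

(** * Classes of paths *)

Section Continuity.
Variables (U V W : topologicalType).

Lemma continuous_compose (f : U -> V) (g : V -> W) :
  continuous f -> continuous g -> continuous (fun x => g (f x)).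
Proof. by move=> fc gc x; apply: continuous_comp; [exact: fc|exact: gc]. Qed.

Lemma continuous_pair (f : U -> V) (g : U -> W) :
  continuous f -> continuous g -> continuous (fun x => (f x, g x)).
Proof. by move=> fc gc x; apply: cvg_pair; [exact: fc|exact: gc]. Qed.

Lemma continuous_pair_at (f : U -> V) (g : U -> W) x :
  {for x, continuous f} -> {for x, continuous g} ->
  {for x, continuous (fun x => (f x, g x))}.
Proof. by move=> fc gc; apply: cvg_pair; [exact: fc|exact: gc]. Qed.

Lemma continuous_compose_at (f : U -> V) (g : V -> W) x :
  {for x, continuous f} -> {for f x, continuous g} ->
  {for x, continuous (fun x => g (f x))}.
Proof. by move=> fc gc; apply: continuous_comp; [exact: fc|exact: gc]. Qed.

End Continuity.

Section Paths.
Variables (R : realType) (X : topologicalType).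

Definition coord k (i : 'I_k.+1) (t : @std_simplex R k) : R := set_val t 0 i.

Lemma continuous_coord k (i : 'I_k.+1) : continuous (@coord k i).
Proof.
move=> t; apply: (@continuous_comp _ _ _ set_val (fun u : 'rV[R]_k.+1 => u 0 i)).
  exact: initial_continuous.
exact: coord_continuous.
Qed.

Lemma continuous_path_simplex (p : R -> X) : continuous p ->
  continuous (fun t : @std_simplex R 1 => p (coord ord_max t)).
Proof. by move=> pc t; apply: continuous_comp; [exact: continuous_coord|exact: pc]. Qed.

Definition path_simplex (p : R -> X) (pc : continuous p) :
    continuousType (@std_simplex R 1) X :=
  mkcts (continuous_path_simplex pc).

Lemma continuous_triangle_simplex (T : R * R -> X) : continuous T ->
  continuous (fun t : @std_simplex R 2 =>
    T (coord (fintype.lift ord0 ord0) t, coord (fintype.lift ord0 ord_max) t)).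
Proof.
move=> Tc; apply: (continuous_compose _ Tc).
by apply: continuous_pair; exact: continuous_coord.
Qed.

Lemma coord_ge0 k (i : 'I_k.+1) (t : @std_simplex R k) : 0 <= coord i t.
Proof.
have [t0 _] : @std_simplex R k (set_val t) by exact: set_valP.
exact: t0.
Qed.

Lemma coord_sum k (t : @std_simplex R k) : \sum_i coord i t = 1.
Proof.
have [_ t1] : @std_simplex R k (set_val t) by exact: set_valP.
exact: t1.
Qed.

Lemma coord_le1 k (i : 'I_k.+1) (t : @std_simplex R k) : coord i t <= 1.
Proof.
rewrite -(coord_sum t) (bigD1 i) //= lerDl sumr_ge0 // => j _.
exact: coord_ge0.
Qed.

Lemma coord_face k (i : 'I_k.+2) j (t : @std_simplex R k) :
  coord j (face i t) = oapp (fun l => coord l t) 0 (unlift i j).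
Proof. by rewrite /coord /= /face_vec mxE. Qed.

End Paths.

Section PathClass.
Variables (R : realType) (X : topologicalType) (Q : zmodType).
Variable (phi : {additive chains R X 1 -> Q}).
(** A function that is not continuous gets the value 0; in this way no proof of
    continuity is carried along. *)
Definition path_class (p : R -> X) : Q :=
  if pselect (continuous p) is left pc then phi << path_simplex pc >> else 0.

Lemma path_classE (p : R -> X) (pc : continuous p)
    (s : continuousType (@std_simplex R 1) X) :
  (forall t, s t = p (coord ord_max t)) -> phi << s >> = path_class p.
Proof.
move=> sp; rewrite /path_class; case: pselect => // pc'.
by congr (phi << _ >>); apply/continuousEP => t; rewrite sp.
Qed.

Lemma path_class_ext (p q : R -> X) : continuous p -> continuous q ->
  (forall s, 0 <= s <= 1 -> p s = q s) -> path_class p = path_class q.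
Proof.
move=> pc qc pq; rewrite -(path_classE pc (s := path_simplex pc)) //.
by apply: path_classE => // t /=; rewrite /mkcts /= pq // coord_ge0 coord_le1.
Qed.

Hypothesis phiB : forall b, phi (@boundary R X 1 b) = 0.

(** On the triangle with vertices (0, 0), (1, 0) and (0, 1) the map [T] is a
    singular 2-simplex, and [phi] vanishes on its boundary. *)
Lemma path_class_triangle (T : R * R -> X) : continuous T ->
  path_class (fun s : R => T (0, s)) = path_class (fun s : R => T (1 - s, s)) +
  path_class (fun s : R => T (s, 0)).
Proof.
move=> Tc; set S := mkcts (continuous_triangle_simplex Tc).
have c1 : continuous (fun s : R => T (0, s)).
  by apply: (continuous_compose _ Tc); apply: continuous_pair => x; [exact: cvg_cst|exact: cvg_id].
have c2 : continuous (fun s : R => T (1 - s, s)).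
  apply: (continuous_compose _ Tc); apply: continuous_pair => x; last exact: cvg_id.
  by apply: cvgB; [exact: cvg_cst|exact: cvg_id].
have c3 : continuous (fun s : R => T (s, 0)).
  by apply: (continuous_compose _ Tc); apply: continuous_pair => x; [exact: cvg_id|exact: cvg_cst].
have l01 (t : @std_simplex R 1) : coord ord0 t = 1 - coord ord_max t.
  have := coord_sum t; rewrite big_ord_recl big_ord1 => <-.
  by rewrite (_ : fintype.lift _ _ = ord_max) ?addrK//; exact/val_inj.
have := phiB << (S : continuousType (@std_simplex R 2) X) >>.
rewrite /boundary liftU scale1r /boundary_simplex !big_ord_recl big_ord0 /=.
rewrite !raddfD /= raddf0 addr0 expr0 scale1r expr1 scaleN1r raddfN /=.
rewrite exprS expr1 mulrNN mulr1 scale1r.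
rewrite (path_classE c2) => [|t]; last first.
  by rewrite /= /mkcts !coord_face !liftK /= l01.
rewrite (path_classE c1) => [|t]; last first.
  rewrite /= /mkcts !coord_face unlift_none /=.
  rewrite (_ : fintype.lift ord0 ord_max = fintype.lift (fintype.lift ord0 ord0) ord_max) ?liftK//.
  exact/val_inj.
rewrite (path_classE c3) => [|t]; last first.
  rewrite /= /mkcts !coord_face.
  rewrite (_ : fintype.lift ord0 ord_max = fintype.lift ord0 (fintype.lift ord0 ord0)) ?unlift_none; last exact/val_inj.
  rewrite (_ : fintype.lift ord0 ord0 = fintype.lift (fintype.lift ord0 (fintype.lift ord0 ord0)) ord_max) ?liftK//.
  exact/val_inj.
by move=> /eqP; rewrite addrCA addrC subr_eq0 => /eqP.
Qed.

Lemma path_class_const (x : X) : path_class (fun => x) = 0.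
Proof.
have := @path_class_triangle (fun => x) (@cst_continuous _ _ x).
by rewrite -[LHS]add0r => /addIr.
Qed.

Definition seg (V : lmodType R) (G : V -> X) (a b : V) (s : R) : X :=
  G (a + s *: (b - a)).

Section Segments.
Variables (V : normedModType R) (G : V -> X).
Hypothesis Gc : continuous G.

Lemma continuous_seg a b : continuous (seg G a b).
Proof.
apply: (continuous_compose _ Gc) => s.
by apply: cvgD; [exact: cvg_cst|apply: cvgZr_tmp; exact: cvg_id].
Qed.

(** [G] maps the triangle with vertices [a], [b] and [c] to [X]. *)
Lemma path_class_trans a b c :
  path_class (seg G a c) = path_class (seg G a b) + path_class (seg G b c).
Proof.
pose T (w : R * R) := G (a + w.1 *: (b - a) + w.2 *: (c - a)).
have Tc : continuous T.
  apply: (continuous_compose _ Gc) => w.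
  apply: cvgD; first apply: cvgD; first exact: cvg_cst.
    by apply: cvgZr_tmp; exact: cvg_fst.
  by apply: cvgZr_tmp; exact: cvg_snd.
have := path_class_triangle Tc.
rewrite (_ : (fun s : R => T (0, s)) = seg G a c); last first.
  by apply/funext => s; rewrite /T /seg /= scale0r addr0.
rewrite (_ : (fun s : R => T (s, 0)) = seg G a b); last first.
  by apply/funext => s; rewrite /T /seg /= scale0r addr0.
rewrite (_ : (fun s : R => T (1 - s, s)) = seg G b c); last first.
  apply/funext => s; rewrite /T /seg /=; congr G.
  by rewrite scalerBl scale1r [a + _]addrA (addrCA a) subrr addr0 -addrA; congr (b + _); rewrite addrC -scalerBr opprB addrA subrK.
by rewrite addrC.
Qed.

Lemma path_class_refl a : path_class (seg G a a) = 0.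
Proof.
rewrite (_ : seg G a a = fun=> G a) ?path_class_const//.
by apply/funext => s; rewrite /seg subrr scaler0 addr0.
Qed.

End Segments.

(** Both ways round the square are homologous to its diagonal. *)
Lemma path_class_square (K : R * R -> X) : continuous K ->
  path_class (fun s : R => K (s, 0)) + path_class (fun s : R => K (1, s)) =
  path_class (fun s : R => K (0, s)) + path_class (fun s : R => K (s, 1)).
Proof.
move=> Kc.
have -> : (fun s : R => K (s, 0)) = seg K (0, 0) (1, 0).
  by apply/funext => s; congr K; congr pair => /=; rewrite !subr0 ?mulr1 ?scaler0 add0r // /GRing.scale /= mulr1.
have -> : (fun s : R => K (1, s)) = seg K (1, 0) (1, 1).
  by apply/funext => s; congr K; congr pair => /=; rewrite ?subrr ?scaler0 ?addr0 // subr0 add0r /GRing.scale /= mulr1.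
have -> : (fun s : R => K (0, s)) = seg K (0, 0) (0, 1).
  by apply/funext => s; congr K; congr pair => /=; rewrite ?subrr ?scaler0 ?addr0 // subr0 add0r /GRing.scale /= mulr1.
have -> : (fun s : R => K (s, 1)) = seg K (0, 1) (1, 1).
  by apply/funext => s; congr K; congr pair => /=; rewrite ?subrr ?scaler0 ?addr0 // subr0 add0r /GRing.scale /= mulr1.
by rewrite -!path_class_trans.
Qed.

(** The straight-line homotopy is a square; its two other sides are constant, as
    the endpoints do not move. *)
Lemma path_class_straighten (V : normedModType R) (G : V -> X) (tau : R -> V) :
  continuous G -> continuous tau ->
  path_class (fun s : R => G (tau s)) = path_class (seg G (tau 0) (tau 1)).
Proof.
move=> Gc tauc.
pose K (w : R * R) := G ((1 - w.2) *: tau w.1 + w.2 *: (tau 0 + w.1 *: (tau 1 - tau 0))).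
have Kc : continuous K.
  apply: (continuous_compose _ Gc) => w.
  have f1 : z.1 @[z --> w] --> w.1 by exact: cvg_fst.
  have f2 : z.2 @[z --> w] --> w.2 by exact: cvg_snd.
  apply: cvgD; apply: cvgZ => //.
  - by apply: cvgB => //; exact: cvg_cst.
  - by apply: continuous_comp => //; exact: tauc.
  - by apply: cvgD; [exact: cvg_cst|exact: cvgZr_tmp].
have := path_class_square Kc; rewrite /K /=.
under [fun s : R => G ((1 - s) *: tau 1 + _)]eq_fun do
  rewrite scale1r [tau 0 + _]addrC subrK -scalerDl subrK scale1r.
under [fun s : R => G ((1 - s) *: tau 0 + _)]eq_fun do
  rewrite scale0r addr0 -scalerDl subrK scale1r.
rewrite !path_class_const addr0 add0r.
under [fun s : R => G ((1 - 0) *: _ + _)]eq_fun do rewrite subr0 scale1r scale0r addr0.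
by under [fun s : R => G ((1 - 1) *: _ + _)]eq_fun do rewrite subrr scale1r scale0r add0r.
Qed.

End PathClass.

(** * The Euclidean disk *)

Section EuclideanNorm.
Variables (R : realType) (k : nat).
Implicit Types (y : 'rV[R]_k) (c : R).

Definition nrm y : R := Num.sqrt (\sum_i y 0 i ^+ 2).

Lemma sumsq_ge0 y : 0 <= \sum_i y 0 i ^+ 2.
Proof. by apply: sumr_ge0 => i _; exact: sqr_ge0. Qed.

Lemma nrm_ge0 y : 0 <= nrm y. Proof. exact: sqrtr_ge0. Qed.

Lemma nrm0 : nrm 0 = 0.
Proof. by rewrite /nrm big1 ?sqrtr0// => i _; rewrite mxE expr0n. Qed.

Lemma nrm_eq0 y : nrm y = 0 -> y = 0.
Proof.
move=> /eqP; rewrite sqrtr_eq0 => y0; apply/rowP => i; rewrite mxE.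
have /eqP := le_anti (introT andP (conj y0 (sumsq_ge0 y))).
rewrite psumr_eq0 => [|j _]; last exact: sqr_ge0.
by move=> /allP/(_ i (mem_index_enum i)); rewrite sqrf_eq0 => /eqP.
Qed.

Lemma nrmZ c y : nrm (c *: y) = `|c| * nrm y.
Proof.
rewrite /nrm -sqrtr_sqr -sqrtrM ?sqr_ge0// mulr_sumr; congr Num.sqrt.
by apply: eq_bigr => i _; rewrite mxE exprMn.
Qed.

Lemma diskE y : disk R k y <-> nrm y <= 1.
Proof. by rewrite /disk /= -{2}sqrtr1 ler_sqrt. Qed.

Lemma open_diskE y : open_disk R k y <-> nrm y < 1.
Proof. by rewrite /open_disk /= -{2}sqrtr1 ltr_sqrt. Qed.

Lemma sphereE y : sphere R k y <-> nrm y = 1.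
Proof.
split=> [|yE]; first by rewrite /sphere /nrm /= => ->; exact: sqrtr1.
by rewrite /sphere /= -[LHS]sqr_sqrtr ?sumsq_ge0// -/(nrm y) yE expr1n.
Qed.

Lemma disk_split y : disk R k y -> open_disk R k y \/ sphere R k y.
Proof.
move=> /diskE; rewrite le_eqVlt => /orP[/eqP|] y1; last by left; apply/open_diskE.
by right; apply/sphereE.
Qed.

Lemma open_disk_disk y : open_disk R k y -> disk R k y.
Proof. by move=> /open_diskE/ltW/diskE. Qed.

Lemma sphere_disk y : sphere R k y -> disk R k y.
Proof. by move=> /sphereE y1; apply/diskE; rewrite y1. Qed.

Lemma nrm_continuous : continuous nrm.
Proof.
move=> y; apply: (@continuous_comp _ _ _ (fun y : 'rV[R]_k => \sum_i y 0 i ^+ 2) Num.sqrt);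
  last exact: sqrt_continuous.
apply: (@continuous_big _ _ +%R 0 xpredT _ _ _ (fun i (y : 'rV[R]_k) => y 0 i ^+ 2)).
  exact: add_continuous.
by move=> i _ {}y; apply: (@continuous_comp _ _ _ (fun y : 'rV[R]_k => y 0 i) (fun x => x ^+ 2)); [exact: coord_continuous|exact: exprn_continuous].
Qed.

Lemma disk_compact : compact (disk R k).
Proof.
apply: (@subclosed_compact _ _ [set v : 'rV[R]_k | forall i, `[(-1) : R, 1]%classic (v 0 i)]).
- rewrite (_ : disk R k = nrm @^-1` [set x | x <= 1]).
    by apply: preimage_closed; [by move=> ? _; exact: nrm_continuous|exact: closed_le].
  by apply/seteqP; split=> y /diskE.
- exact: (@rV_compact R k (fun _ => `[(-1) : R, 1]%classic) (fun _ => @segment_compact _ _ _)).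
move=> y /diskE y1 i /=; rewrite in_itv /= -ler_norml.
apply: le_trans y1; rewrite -sqrtr_sqr ler_sqrt ?sumsq_ge0//.
by rewrite (bigD1 i) //= lerDl sumr_ge0 // => j _; exact: sqr_ge0.
Qed.

(** Stretch by [c], then cut off at the unit sphere. *)
Definition push c y : 'rV[R]_k := (c / Num.max 1 (c * nrm y)) *: y.

Lemma max1_gt0 (x : R) : 0 < Num.max 1 x.
Proof. by rewrite lt_max ltr01. Qed.

Lemma nrm_push c y : 0 <= c -> nrm (push c y) = (c * nrm y) / Num.max 1 (c * nrm y).
Proof.
move=> c0; rewrite /push nrmZ ger0_norm; first by rewrite mulrAC.
exact: divr_ge0 c0 (ltW (max1_gt0 _)).
Qed.

Lemma push_disk c y : 0 <= c -> disk R k (push c y).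
Proof.
move=> c0; apply/diskE; rewrite nrm_push// ler_pdivrMr ?max1_gt0// mul1r.
by rewrite le_max lexx orbT.
Qed.

Lemma push_sphere c y : 1 <= c * nrm y -> 0 <= c -> sphere R k (push c y).
Proof.
move=> cy c0; apply/sphereE; rewrite nrm_push// max_r// divff//.
by rewrite gt_eqF// (lt_le_trans _ cy).
Qed.

Lemma push_id c y : sphere R k y -> 1 <= c -> push c y = y.
Proof.
move=> /sphereE y1 c1; rewrite /push y1 mulr1 max_r// divff ?scale1r//.
by rewrite gt_eqF// (lt_le_trans _ c1).
Qed.

Lemma push1 y : disk R k y -> push 1 y = y.
Proof. by move=> /diskE y1; rewrite /push (mul1r (nrm y)) max_l// divr1 scale1r. Qed.

Lemma push_continuous : continuous (fun w : 'rV[R]_k * R => push w.2 w.1).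
Proof.
move=> w; rewrite /push.
have f1 : z.1 @[z --> w] --> w.1 by exact: cvg_fst.
have f2 : z.2 @[z --> w] --> w.2 by exact: cvg_snd.
have cn : z.2 * nrm z.1 @[z --> w] --> w.2 * nrm w.1.
  apply: cvgM => //; apply: continuous_comp; [exact: f1|exact: nrm_continuous].
apply: cvgZ => //; apply: cvgM => //; apply: cvgV.
  by rewrite gt_eqF// max1_gt0.
have mc : {for w, continuous ((cst 1 : 'rV[R]_k * R -> R^o) \max (fun z => z.2 * nrm z.1 : R^o))}.
  by apply: continuous_max => //; exact: cvg_cst.
exact: mc.
Qed.

(** [push 1] is the retraction of the whole space onto the closed disk. *)
Lemma retraction_continuous : continuous (push 1).
Proof.
have pc : continuous (fun y : 'rV[R]_k => (y, 1 : R)).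
  by apply: continuous_pair; [move=> y; exact: cvg_id|exact: cst_continuous].
move=> y; exact: (continuous_compose pc push_continuous).
Qed.

Definition normalize y := (nrm y)^-1 *: y.

Lemma normalize_sphere y : y != 0 -> sphere R k (normalize y).
Proof.
move=> y0; apply/sphereE; rewrite nrmZ ger0_norm ?invr_ge0 ?nrm_ge0// mulVf//.
by apply: contra y0 => /eqP/nrm_eq0/eqP.
Qed.

Lemma normalize_id y : sphere R k y -> normalize y = y.
Proof. by move=> /sphereE y1; rewrite /normalize y1 invr1 scale1r. Qed.

(** The segment between points that are not antipodal misses the origin, hence can
    be projected to the sphere. *)
Lemma sphere_path y z : sphere R k y -> sphere R k z -> z <> - y ->
  exists tau : R -> 'rV[R]_k,
    [/\ continuous tau, forall s, sphere R k (tau s), tau 0 = y & tau 1 = z].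
Proof.
move=> Sy Sz zy; pose w (s : R) := y + s *: (z - y).
have w0 s : w s != 0.
  apply/eqP => ws.
  have E : (1 - s) *: y = - (s *: z).
    by apply/eqP; rewrite -addr_eq0 -ws /w scalerBr scalerBl scale1r addrA addrAC.
  have : nrm ((1 - s) *: y) = nrm ((- s) *: z) by rewrite E scaleNr.
  rewrite !nrmZ (iffLR (sphereE y) Sy) (iffLR (sphereE z) Sz) !mulr1 normrN => /eqP.
  rewrite eqr_norm2 => /orP[|]/eqP s2; last by move: s2 => /eqP; rewrite subr_eq addrC subrr oner_eq0.
  have s0 : s != 0 by apply/eqP => s0; move: s2; rewrite s0 subr0 => /eqP; rewrite oner_eq0.
  apply: zy; apply: (scalerI s0).
  by rewrite scalerN; apply/eqP; rewrite -eqr_oppLR -E s2.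
exists (normalize \o w); split=> [s|s||] /=.
- have wc : w z @[z --> s] --> w s.
    by apply: cvgD; [exact: cvg_cst|apply: cvgZr_tmp; exact: cvg_id].
  apply: cvgZ => //; apply: cvgV.
    by apply: contra (w0 s) => /eqP/nrm_eq0/eqP.
  by apply: (continuous_comp wc); exact: nrm_continuous.
- exact: normalize_sphere.
- by rewrite /w scale0r addr0 normalize_id.
- by rewrite /w scale1r addrC subrK normalize_id.
Qed.

End EuclideanNorm.

(** An intermediate point through which [sphere_path] joins antipodal points; this
    is where the dimension has to be at least 2. *)
Lemma sphere_third (R : realType) k (y : 'rV[R]_k.+2) : sphere R _ y ->
  exists2 z, sphere R _ z & z <> y /\ z <> - y.
Proof.
move=> Sy.
have Sd (i : 'I_k.+2) : sphere R _ (delta_mx 0 i).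
  rewrite /sphere /= (bigD1 i) //= big1 => [|j ji]; rewrite mxE eqxx ?eqxx ?expr1n ?addr0//=.
  by rewrite (negPf ji) expr0n.
have [y0|y0] := pselect (exists c, y = c *: delta_mx 0 ord0); last first.
  exists (delta_mx 0 ord0) => //; split=> E; apply: y0.
    by exists 1; rewrite scale1r.
  by exists (-1); rewrite scaleN1r E opprK.
case: y0 => c yE; exists (delta_mx 0 ord_max) => //.
have d1 : (delta_mx 0 ord_max : 'rV[R]_k.+2) 0 ord_max = 1 by rewrite mxE !eqxx.
have d0 : (delta_mx 0 ord0 : 'rV[R]_k.+2) 0 ord_max = 0 by rewrite mxE eqxx.
by split=> E; move: d1; rewrite E yE; rewrite -?scalerN !mxE ?mxE eqxx [ord_max == _](_ : _ = false)// ?oppr0 mulr0 => /eqP; rewrite eq_sym oner_eq0.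
Qed.

(** * Cells *)

(** Applied to functions of the endpoint of a path, this does the work of a
    subdivision of the path by a Lebesgue number. *)
Lemma locally_constant_eq (R : realType) (T : Type) (f : R -> T) :
  (forall s0, \forall s \near s0, f s = f s0) -> forall a b, f a = f b.
Proof.
move=> loc; suff H a b : a <= b -> f a = f b.
  by move=> a b; have [/H|/ltW/H] := leP a b.
move=> ab.
have op (c : R) : open [set s | f s = f c].
  rewrite openE => s /= sc; rewrite /interior /=.
  by apply: filterS (loc s) => u; rewrite -sc.
have -> : f a = f b; last by [].
pose B := `[a, b]%classic `&` [set s | f s = f a].
suff : B = `[a, b]%classic.
  move=> BE; have : `[a, b]%classic b by rewrite /= in_itv /= ab lexx.
  by rewrite -BE => -[].
apply: segment_connected.
- by exists a; split=> //; rewrite /= in_itv /= ab lexx.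
- by exists [set s | f s = f a].
exists [set s | f s = f a] => //; rewrite -openC openE => s /= sa.
by apply: filterS (loc s) => u /= -> .
Qed.

Lemma within_continuous_retract (U V W : topologicalType) (A : set V)
    (f : V -> W) (r : U -> V) :
  {within A, continuous f} -> continuous r -> (forall x, A (r x)) ->
  continuous (fun x => f (r x)).
Proof.
move=> /subspace_continuousP fc rc rA x O /(fc _ (rA x)) H.
suff: \forall z \near x, O (f (r z)) by [].
have : \forall z \near x, A (r z) -> O (f (r z)) := rc x _ H.
by apply: filterS => z; apply; exact: rA.
Qed.

Section Cells.
Variables (R : realType) (X : topologicalType) (W : cw_complex R X).

Definition body (F : set {j & cell W j}) : set X :=
  \bigcup_(c in F) open_cell (tagged c).

Section Cell.
Variables (k : nat) (e : cell W k).

(** The characteristic map, extended to the whole space along the retraction to the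
    disk; continuity then holds everywhere and not only within the disk. *)
Definition chi (y : 'rV[R]_k) : X := cell_map e (push 1 y).

Lemma chi_continuous : continuous chi.
Proof.
have pD y : disk R k (push 1 y) by exact: push_disk.
exact: (within_continuous_retract (@cell_map_continuous _ _ W k e)
  (@retraction_continuous R k) pD).
Qed.

Lemma chi_id y : disk R k y -> chi y = cell_map e y.
Proof. by move=> yD; rewrite /chi push1. Qed.

Lemma open_cellP x : open_cell e x <-> exists2 y, open_disk R k y & chi y = x.
Proof.
split=> [[y yD <-]|[y yD <-]]; exists y => //; rewrite chi_id//; exact: open_disk_disk.
Qed.

Lemma chi_inj y z : open_disk R k y -> open_disk R k z -> chi y = chi z -> y = z.
Proof.
move=> yD zD; rewrite !chi_id; try exact: open_disk_disk.
by move=> E; apply: (@cell_map_inj _ _ W k e) => //; rewrite inE.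
Qed.

Definition cell_coord (x : X) : 'rV[R]_k := xget 0 [set y | open_disk R k y /\ chi y = x].

Lemma cell_coordP x : open_cell e x -> open_disk R k (cell_coord x) /\ chi (cell_coord x) = x.
Proof.
move=> /open_cellP[y yD yx]; rewrite /cell_coord; case: xgetP => [z -> //|/(_ y)[]] //.
Qed.

Lemma cell_coordK y : open_disk R k y -> cell_coord (chi y) = y.
Proof.
move=> yD; have [|cD cE] := @cell_coordP (chi y); first by apply/open_cellP; exists y.
exact: chi_inj cE.
Qed.

(** An open set of coordinates is the trace on the cell of an open set of [X], by
    [cell_map_open]. *)
Lemma cell_coord_continuous (T : topologicalType) (f : T -> X) (x : T) :
  {for x, continuous f} -> (\forall z \near x, open_cell e (f z)) ->
  {for x, continuous (cell_coord \o f)}.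
Proof.
move=> fc fe O; rewrite /= nbhsE => -[U [Uo Ux] UO].
have [V Vo VE] := cell_map_open e Uo.
have fx := nbhs_singleton fe.
have [cD cE] := cell_coordP fx.
have Vx : V (f x).
  have : [set cell_map e z | z in open_disk R k `&` U] (f x).
    by exists (cell_coord (f x)) => //; rewrite -chi_id//; exact: open_disk_disk.
  by rewrite VE => -[].
have : nbhs (f x) V by exact: open_nbhs_nbhs.
move=> /fc fV.
suff: \forall z \near x, O (cell_coord (f z)) by [].
near=> z.
apply: UO; have : (open_cell e `&` V) (f z).
  by split; near: z; [exact: fe|exact: fV].
rewrite -VE => -[y [yD Uy] yz] /=.
by rewrite -yz -chi_id ?cell_coordK//; exact: open_disk_disk.
Unshelve. all: by end_near.
Qed.

End Cell.
End Cells.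

(** * Attaching a cell *)

Section Clamp.
Variable R : realType.

Definition clamp (u : R) : R := Num.max 0 (Num.min 1 u).

Lemma clamp_continuous : continuous clamp.
Proof.
move=> u; rewrite /clamp.
have mc : {for u, continuous ((cst 0 : R -> R^o) \max ((cst 1 : R -> R^o) \min (id : R -> R^o)))}.
  apply: continuous_max; first exact: cvg_cst.
  by apply: continuous_min; [exact: cvg_cst|exact: cvg_id].
exact: mc.
Qed.

Lemma clamp_ge0 u : 0 <= clamp u. Proof. by rewrite le_max lexx. Qed.

Lemma clamp_le1 u : clamp u <= 1.
Proof. by rewrite ge_max ler01 ge_min lexx. Qed.

Lemma clamp_id u : 0 <= u <= 1 -> clamp u = u.
Proof. by move=> /andP[u0 u1]; rewrite /clamp min_r// max_r. Qed.

Lemma clamp0 : clamp 0 = 0. Proof. by rewrite clamp_id// lexx ler01. Qed.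
Lemma clamp1 : clamp 1 = 1. Proof. by rewrite clamp_id// lexx ler01. Qed.
End Clamp.

Section SphereCases.
Variables (R : realType) (k : nat) (y : 'rV[R]_k).
Hypothesis Sy : sphere R k y.

Lemma sphere_dim_gt0 : (0 < k)%N.
Proof.
case: k y Sy => // z; rewrite /sphere /= big_ord0 => /eqP.
by rewrite eq_sym oner_eq0.
Qed.

Lemma sphere_dim1 : k = 1%N -> y = const_mx 1 \/ y = const_mx (-1).
Proof.
move=> k1; subst k; move: Sy; rewrite /sphere /= big_ord1 => /eqP.
by rewrite sqrf_eq1 => /orP[] /eqP E; [left|right]; apply/rowP => i; rewrite (ord1 i) E mxE.
Qed.

Lemma sphere_dim_gt1 : (1 < k)%N ->
  exists2 z, sphere R k z & z <> y /\ z <> - y.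
Proof. by case: k y Sy => [|[|j]] // z Sz _; exact: sphere_third. Qed.

End SphereCases.

Section Potential.
Variables (R : realType) (X : topologicalType) (Q : zmodType).
Variable (phi : {additive chains R X 1 -> Q}).
Hypothesis phiB : forall b, phi (@boundary R X 1 b) = 0.
Local Notation path_class := (path_class phi).

(** The difference of the two sides, as a function of the endpoint of an initial
    piece of [sigma], is locally constant. *)
Lemma path_class_local (g : X -> Q) (sigma : R -> X) : continuous sigma ->
  (forall s0, exists2 eps : R, 0 < eps & forall rho : R -> R, continuous rho ->
     (forall u, `|rho u - s0| < eps) ->
     path_class (fun u => sigma (rho u)) = g (sigma (rho 1)) - g (sigma (rho 0))) ->
  path_class sigma = g (sigma 1) - g (sigma 0).
Proof.
move=> sc loc; pose f (s : R) := path_class (seg (V := R^o) sigma 0 s) - g (sigma s).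
have segE : seg (V := R^o) sigma 0 1 = sigma.
  by apply/funext => s; rewrite /seg subr0 add0r /GRing.scale /= mulr1.
suff H : f 1 = f 0.
  move: H; rewrite /f segE (@path_class_refl R X Q phi phiB R^o) sub0r => H.
  by apply/eqP; rewrite -subr_eq0 opprB addrA addrAC addrC H subrr.
apply: locally_constant_eq => s0; have [eps eps0 H] := loc s0.
near=> s.
have seps : `|s - s0| < eps.
  by rewrite distrC; near: s; apply: nbhsx_ballx.
pose rho u := s0 + clamp u * (s - s0).
have rc : continuous rho.
  move=> u; apply: cvgD; first exact: cvg_cst.
  by apply: cvgM; [exact: clamp_continuous|exact: cvg_cst].
have r0 : rho 0 = s0 by rewrite /rho clamp0 mul0r addr0.
have r1 : rho 1 = s by rewrite /rho clamp1 mul1r addrC subrK.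
have reps u : `|rho u - s0| < eps.
  rewrite /rho [s0 + _]addrC addrK normrM (le_lt_trans _ seps)//.
  by rewrite ger0_norm ?clamp_ge0// ler_piMl// clamp_le1.
have := H rho rc reps; rewrite r0 r1 => {}H.
rewrite /f (@path_class_trans R X Q phi phiB R^o sigma sc 0 s0 s).
rewrite (@path_class_ext _ _ _ phi (seg (V := R^o) sigma s0 s) (fun u => sigma (rho u))).
- by rewrite H -addrA [_ - _ - g (sigma s)]addrAC subrr sub0r.
- exact: (@continuous_seg R X R^o).
- exact: continuous_compose rc sc.
- by move=> u u01; rewrite /seg /rho clamp_id.
Unshelve. all: by end_near. Qed.

Variable (W : cw_complex R X).

(** The disk of dimension 1 is the interval from -1 to 1. *)
Hypothesis edges : forall e : cell W 1,
  path_class (seg (chi e) (const_mx (-1)) (const_mx 1)) = 0.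

(** If [phi] vanishes on edges, a potential may be normalized to vanish on all
    vertices; this makes the extension over an edge possible. *)
Definition potential (F : set {j & cell W j}) (g : X -> Q) : Prop :=
  (forall v : cell W 0, g (cell_map v 0) = 0) /\
  (forall sigma, continuous sigma -> (forall s, body F (sigma s)) ->
     path_class sigma = g (sigma 1) - g (sigma 0)).

Section Attach.
Variables (F : set {j & cell W j}) (g : X -> Q) (k : nat) (e : cell W k).
Hypothesis Fpot : potential F g.
Hypothesis Fclosed : closed (body F).
Hypothesis Fe : ~ F (existT _ k e).
Hypothesis eF : [set cell_map e y | y in sphere R k] `<=` body F.

Local Notation rad y := (path_class (seg (chi e) 0 y)).

Lemma path_class_chi tau : continuous tau ->
  path_class (fun s => chi e (tau s)) = rad (tau 1) - rad (tau 0).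
Proof.
move=> tc; rewrite (@path_class_straighten R X Q phi phiB _ (chi e) tau (@chi_continuous _ _ _ _ _) tc).
rewrite (@path_class_trans R X Q phi phiB _ (chi e) (@chi_continuous _ _ _ _ _) 0 (tau 0) (tau 1)).
by rewrite addrC addKr.
Qed.

Lemma body_disjoint x : body F x -> open_cell e x -> False.
Proof.
by move=> [[j c] Fc cx] ex; apply: Fe; rewrite (cells_disjoint ex cx).
Qed.

Lemma sphere_body y : sphere R k y -> body F (chi e y).
Proof. by move=> Sy; apply: eF; exists y => //; rewrite chi_id//; exact: sphere_disk. Qed.

Lemma cell0_value (v : cell W 0) x : open_cell v x -> g x = 0.
Proof.
by move=> [y _ <-]; rewrite (_ : y = 0) ?Fpot.1//; apply/rowP => -[].
Qed.

(** In dimension at least 2 the points [y] and [z] are joined by a path in the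
    sphere, on which [g] is a potential; inside the disk this path is homotopic to
    the segment from [y] to [z]. In dimension 1 both sides vanish: [y] and [z] are
    vertices, and the edge has class 0. *)
Lemma sphere_potential y z : sphere R k y -> sphere R k z ->
  g (chi e z) - g (chi e y) = rad z - rad y.
Proof.
move=> Sy Sz.
have path a b : sphere R k a -> sphere R k b -> b <> - a ->
    g (chi e b) - g (chi e a) = rad b - rad a.
  move=> Sa Sb ba; have [tau [tc tS t0 t1]] := sphere_path Sa Sb ba.
  have := path_class_chi tc; rewrite t0 t1 => <-.
  have [_ /(_ (fun s => chi e (tau s)))] := Fpot; rewrite t0 t1 => -> //.
    exact: continuous_compose tc (@chi_continuous _ _ _ _ _).
  by move=> s; exact: sphere_body.
have [zy|] := pselect (z = - y); last exact: path.
have [k1|k1] := leqP k 1; last first.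
  have [w Sw [wy wNy]] := sphere_dim_gt1 Sy k1.
  have zw : z <> - w by rewrite zy => /oppr_inj/esym.
  by rewrite -(subrKA (g (chi e w))) (path _ _ Sw Sz zw) (path _ _ Sy Sw wNy) subrKA.
have {}k1 : k = 1%N by apply/eqP; rewrite eqn_leq k1 (sphere_dim_gt0 Sy).
have g0 w : sphere R k w -> g (chi e w) = 0.
  move=> Sw; have [G [_ Gk] /(_ (chi e w))[]] := cw_closure_finite e.
    by exists w => //; rewrite chi_id//; exact: sphere_disk.
  move=> [j c] Gc /= cw; have jk : (j < k)%N := Gk _ Gc.
  have j0 : j = 0%N by move: jk; rewrite k1 ltnS leqn0 => /eqP.
  by subst j; exact: cell0_value cw.
have ek : rad (const_mx 1) = rad (const_mx (-1)).
  apply/eqP; rewrite -subr_eq0; apply/eqP.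
  rewrite (@path_class_trans R X Q phi phiB _ (chi e) (@chi_continuous _ _ _ _ _) 0 (const_mx (-1)) (const_mx 1)).
  by rewrite addrC addKr; move: (e); rewrite k1; exact: edges.
rewrite !g0// subrr; apply/esym/eqP; rewrite subr_eq0; apply/eqP.
by have [->|->] := sphere_dim1 Sy k1; have [->|->] := sphere_dim1 Sz k1; rewrite ?ek.
Qed.

(** The value of the extended potential at the centre of the cell. For a vertex it
    is 0, to keep the normalization. *)
Lemma attaching_constant : exists2 c,
  (forall y, sphere R k y -> g (chi e y) = c + rad y) & (k = 0 -> c = 0).
Proof.
have [[y Sy]|nS] := pselect (exists y, sphere R k y).
  exists (g (chi e y) - rad y) => [z Sz|k0].
    by rewrite -addrA [- _ + _]addrC -(sphere_potential Sy Sz) addrC subrK.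
  by exfalso; have := sphere_dim_gt0 Sy; rewrite k0.
by exists 0 => // y Sy; exfalso; apply: nS; exists y.
Qed.

Section Extension.
Variable c : Q.
Hypothesis cE : forall y, sphere R k y -> g (chi e y) = c + rad y.
Hypothesis c0 : k = 0 -> c = 0.

Definition extension (x : X) : Q :=
  if pselect (open_cell e x) then c + rad (cell_coord e x) else g x.

Lemma extension_body x : body F x -> extension x = g x.
Proof.
by move=> Fx; rewrite /extension; case: pselect => // ex; exfalso; exact: body_disjoint Fx ex.
Qed.

Lemma extension_chi y : disk R k y -> extension (chi e y) = c + rad y.
Proof.
move=> /disk_split[yD|Sy]; last by rewrite extension_body ?cE//; exact: sphere_body.
rewrite /extension; case: pselect => [ey|ny]; first by rewrite cell_coordK.
by exfalso; apply: ny; apply/open_cellP; exists y.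
Qed.

Lemma extension_vertex (v : cell W 0) : extension (cell_map v 0) = 0.
Proof.
rewrite /extension; case: pselect => [ev|nev]; last exact: Fpot.1.
have v0 : open_cell v (cell_map v 0).
  by exists 0 => //; rewrite /open_disk /= big_ord0 ltr01.
have k0 : k = 0%N.
  by have := congr1 (@tag _ _) (cells_disjoint ev v0).
rewrite c0// add0r (_ : cell_coord e _ = 0) ?(@path_class_refl R X Q phi phiB)//.
by apply/rowP => i; exfalso; move: i; rewrite k0 => -[].
Qed.

Lemma path_class_extension tau : continuous tau -> (forall s, disk R k (tau s)) ->
  path_class (fun s => chi e (tau s)) = extension (chi e (tau 1)) - extension (chi e (tau 0)).
Proof.
move=> tc tD; rewrite path_class_chi// !extension_chi//.
by rewrite opprD addrACA subrr add0r.
Qed.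

(** A homotopy that starts at the identity, stretches the open cell away from its
    centre and fixes all other points. At time 1 it has swept the outer half of the
    cell into the boundary. The absolute value makes it defined at all real times. *)
Definition flow (x : X) (t : R) : X :=
  if pselect (open_cell e x) then chi e (push (1 + `|t|) (cell_coord e x)) else x.

Lemma flow_out x t : ~ open_cell e x -> flow x t = x.
Proof. by rewrite /flow; case: pselect. Qed.

Lemma flow_in x t : open_cell e x -> flow x t = chi e (push (1 + `|t|) (cell_coord e x)).
Proof. by rewrite /flow; case: pselect. Qed.

Lemma scale_continuous : continuous (fun t : R => 1 + `|t|).
Proof. by move=> t; apply: cvgD; [exact: cvg_cst|exact: norm_continuous]. Qed.

Lemma flow0 x : flow x 0 = x.
Proof.
have [ex|ex] := pselect (open_cell e x); last exact: flow_out.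
have [cD cE'] := cell_coordP ex.
by rewrite flow_in// normr0 addr0 push1//; exact: open_disk_disk.
Qed.

Lemma open_cell_near (T : topologicalType) (f : T -> X) (x : T) :
  {for x, continuous f} -> (forall z, body (existT _ k e |` F) (f z)) ->
  open_cell e (f x) -> \forall z \near x, open_cell e (f z).
Proof.
move=> fc fF ex.
have : nbhs (f x) (~` body F).
  apply: open_nbhs_nbhs; split; first exact: closed_openC.
  by move=> Fx; exact: (body_disjoint Fx ex).
move=> /fc H; have {}H : \forall z \near x, ~ body F (f z) := H.
apply: filterS H => z /= nF.
have [d [->|Fd] dz] := fF z; first exact: dz.
by exfalso; apply: nF; exists d.
Qed.

(** Only a parameter [w] with [pi w.1] outside the open cell needs care. A point
    [y] of the disk is on the sphere and does not move, if [chi e y] is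
    [pi w.1]; otherwise [pi] stays away from [chi e y] near [w]. By compactness of
    the disk this holds near [w] uniformly in [y]. *)
Lemma flow_path_continuous (pi : R -> X) : continuous pi ->
  (forall s, body (existT _ k e |` F) (pi s)) ->
  continuous (fun w : R * R => flow (pi w.1) w.2).
Proof.
move=> pc piF w.
have fstc : {for w, continuous (fun z : R * R => z.1)} by exact: cvg_fst.
have sndc : {for w, continuous (fun z : R * R => z.2)} by exact: cvg_snd.
have p1c : {for w, continuous (fun z : R * R => pi z.1)}.
  exact: continuous_compose_at fstc (pc _).
have scale2 : {for w, continuous (fun z : R * R => 1 + `|z.2|)}.
  exact: (continuous_compose_at (g := fun t : R => 1 + `|t|) sndc (@scale_continuous _)).
have [ex|nex] := pselect (open_cell e (pi w.1)).
  have en : \forall z \near w, open_cell e (pi z.1).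
    exact: (open_cell_near p1c (fun z => piF z.1) ex).
  have cooc : {for w, continuous (fun z : R * R => cell_coord e (pi z.1))}.
    exact: (@cell_coord_continuous _ _ _ _ e _ (fun z : R * R => pi z.1) w p1c en).
  have pushc : {for w, continuous (fun z : R * R => chi e (push (1 + `|z.2|) (cell_coord e (pi z.1))))}.
    have pairc := continuous_pair_at cooc scale2.
    exact: (continuous_compose_at (continuous_compose_at pairc (@push_continuous R k _)) (@chi_continuous _ _ _ _ e _)).
  move=> O; rewrite flow_in// => /pushc H.
  have {}H : \forall z \near w, O (chi e (push (1 + `|z.2|) (cell_coord e (pi z.1)))) := H.
  suff : \forall z \near w, O (flow (pi z.1) z.2) by [].
  near=> z; rewrite flow_in; first by near: z.
  by near: z.
move=> O; rewrite flow_out// => Ox.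
suff : \forall z \near w, O (flow (pi z.1) z.2) by [].
have /compact_near_coveringP ncov := @disk_compact R k.
have cov : \forall z \near w, disk R k `<=`
    (fun y => chi e y = pi z.1 -> O (chi e (push (1 + `|z.2|) y))).
  apply: (ncov _ (nbhs w) (fun z y => chi e y = pi z.1 -> O (chi e (push (1 + `|z.2|) y)))).
  move=> y0 y0D; have [yx|yx] := pselect (chi e y0 = pi w.1).
    have Sy : sphere R k y0.
      by have [yo|//] := disk_split y0D; exfalso; apply: nex; apply/open_cellP; exists y0.
    have yid : push (1 + `|w.2|) y0 = y0 by rewrite push_id// lerDl.
    have c3 : {for (y0, w), continuous (fun z : 'rV[R]_k * (R * R) => chi e (push (1 + `|z.2.2|) z.1))}.
      have c0' : {for (y0, w), continuous (fun z : 'rV[R]_k * (R * R) => z.2)} by exact: cvg_snd.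
      have c1' : {for (y0, w), continuous (fun z : 'rV[R]_k * (R * R) => z.1)} by exact: cvg_fst.
      have pairc := continuous_pair_at c1' (continuous_compose_at c0' scale2).
      exact: (continuous_compose_at (continuous_compose_at pairc (@push_continuous R k _)) (@chi_continuous _ _ _ _ e _)).
    have /c3 H : nbhs (chi e (push (1 + `|w.2|) y0)) O by rewrite yid yx.
    have {}H : \forall z \near (y0, w), O (chi e (push (1 + `|z.2.2|) z.1)) := H.
    by apply: filterS H => z.
  have := cw_hausdorff W; rewrite open_hausdorff.
  move=> /(_ (chi e y0) (pi w.1)); case.
    by apply/eqP.
  move=> [A B] /= [/set_mem Ay /set_mem Bx] [Ao Bo AB].
  have An : \forall y \near y0, A (chi e y).
    apply: (@chi_continuous _ _ _ _ e y0); exact: open_nbhs_nbhs.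
  have Bn : \forall z \near w, B (pi z.1).
    apply: p1c; exact: open_nbhs_nbhs.
  exists ([set y | A (chi e y)], [set z | B (pi z.1)]) => //= -[y z] [/= Ayz Byz] yz.
  exfalso; have : (A `&` B) (pi z.1) by split=> //; rewrite -yz.
  by rewrite (eqP AB).
have Op : \forall z \near w, O (pi z.1) := p1c _ Ox.
near=> z.
have [ez|nez] := pselect (open_cell e (pi z.1)).
  rewrite flow_in//; have [cD cEq] := cell_coordP ez.
  by apply: (near cov z); last exact: cEq; [|exact: open_disk_disk].
by rewrite flow_out//; near: z.
Unshelve. all: by end_near. Qed.

(** Near a parameter at which the path is in the open cell, it lifts to the disk.
    Near any other parameter it avoids the inner half of the cell; then the flow
    deforms it into [body F], where [g] is a potential, and the tracks of its
    endpoints are radial paths, which lift to the disk. *)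
Lemma extension_potential : potential (existT _ k e |` F) extension.
Proof.
split=> [v|sigma sc sF]; first exact: extension_vertex.
apply: path_class_local => // s0.
have [es0|nes0] := pselect (open_cell e (sigma s0)).
  have := open_cell_near (sc s0) sF es0.
  move=> /nbhs_ballP[eps /= eps0 He]; exists eps => // rho rc rhoe.
  have en u : open_cell e (sigma (rho u)).
    by apply: He; rewrite /ball /= distrC.
  have tc : continuous (fun u => cell_coord e (sigma (rho u))).
    move=> u; apply: (@cell_coord_continuous _ _ _ _ e _ (fun u => sigma (rho u)) u).
      exact: (continuous_compose_at (rc u) (sc _)).
    by near=> z; exact: en.
  have tE u : chi e (cell_coord e (sigma (rho u))) = sigma (rho u) by case: (cell_coordP (en u)).
  rewrite (_ : (fun u => sigma (rho u)) = fun u => chi e (cell_coord e (sigma (rho u)))); last first.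
    by apply/funext => u; rewrite tE.
  rewrite path_class_extension ?tE// => u.
  by apply: open_disk_disk; case: (cell_coordP (en u)).
(* The image of the inner half disk is compact, so the path avoids it near [s0]. *)
pose half := [set chi e y | y in [set y | nrm y <= 2^-1]].
have half_open : half `<=` open_cell e.
  move=> x [y /= y1 <-]; apply/open_cellP; exists y => //; apply/open_diskE.
  by rewrite (le_lt_trans y1)// invf_lt1 ?ltr1n.
have half_closed : closed half.
  apply: compact_closed; first exact: cw_hausdorff W.
  apply: continuous_compact; first exact/continuous_subspaceT/chi_continuous.
  apply: (@subclosed_compact _ _ (disk R k)); last 2 first.
  - exact: disk_compact.
  - by move=> y /= y1; apply/diskE; rewrite (le_trans y1)// invf_le1 ?ler1n.
  rewrite (_ : [set _ | _] = @nrm R k @^-1` [set x | x <= 2^-1])//.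
  by apply: preimage_closed; [move=> ? _; exact: nrm_continuous|exact: closed_le].
have : \forall s \near s0, ~ half (sigma s).
  have : nbhs (sigma s0) (~` half).
    apply: open_nbhs_nbhs; split; first exact: closed_openC.
    by move=> /half_open.
  by move=> /sc.
move=> /nbhs_ballP[eps /= eps0 He]; exists eps => // rho rc rhoe.
pose pi u := sigma (rho u).
have pic : continuous pi := continuous_compose rc sc.
have piF u : body (existT _ k e |` F) (pi u) by exact: sF.
have pih u : ~ half (pi u) by apply: He; rewrite /ball /= distrC.
have Kc := flow_path_continuous pic piF.
(* The sides of the square are [pi], its push into [body F] and two tracks. *)
have := @path_class_square R X Q phi phiB _ Kc.
have -> : (fun s : R => flow (pi (s, 0 : R).1) (s, 0 : R).2) = (fun s => pi s).
  by apply/funext => s; exact: flow0.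
have flow1 u : body F (flow (pi u) 1).
  have [eu|neu] := pselect (open_cell e (pi u)).
    rewrite flow_in//; apply: sphere_body; apply: push_sphere; last by rewrite addr_ge0.
    rewrite normr1 -[leLHS](@mulfV _ 2%:R) ?pnatr_eq0// ler_pM2l// leNgt; apply/negP => ltc.
    by apply: (pih u); exists (cell_coord e (pi u)); [exact: ltW|case: (cell_coordP eu)].
  rewrite flow_out//; have [d [dE|Fd] dx] := piF u; last by exists d.
  by exfalso; apply: neu; rewrite dE in dx.
have track x : path_class (fun s => flow x s) = extension (flow x 1) - extension x.
  have [ex|nex] := pselect (open_cell e x); last first.
    rewrite (_ : (fun s => flow x s) = fun=> x); last first.
      by apply/funext => s; exact: flow_out.
    by rewrite flow_out// subrr (@path_class_const R X Q phi phiB).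
  rewrite (_ : (fun s => flow x s) = fun s => chi e (push (1 + `|s|) (cell_coord e x))); last first.
    by apply/funext => s; exact: flow_in.
  have tc : continuous (fun s : R => push (1 + `|s|) (cell_coord e x)).
    have cc : continuous (fun s : R => (cell_coord e x, 1 + `|s|)).
      by apply: continuous_pair; [exact: cst_continuous|exact: scale_continuous].
    exact: (continuous_compose cc (@push_continuous R k)).
  rewrite (path_class_extension tc) => [|s]; last by apply: push_disk; rewrite addr_ge0.
  by rewrite -!flow_in// flow0.
rewrite /= !track.
have f1c : continuous (fun s : R => flow (pi s) 1).
  have cc : continuous (fun s : R => (s, 1 : R)).
    by apply: continuous_pair; [move=> ?; exact: cvg_id|exact: cst_continuous].
  exact: (continuous_compose cc Kc).
rewrite (Fpot.2 _ f1c flow1) -!(extension_body (flow1 _)) -/(pi 0) -/(pi 1) -/pi.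
move: (path_class pi) (extension (pi 0)) (extension (pi 1)) => a b b'.
move: (extension _) (extension _) => d d' E.
by apply: (addIr (d' - b')); rewrite E addrC addrA subrK [RHS]addrC addrA subrK.
Unshelve. all: by end_near. Qed.

End Extension.
End Attach.
End Potential.

(** * Finite subcomplexes *)

Section FiniteSubcomplexes.
Variables (R : realType) (X : topologicalType) (W : cw_complex R X).
Local Notation cells := {j & cell W j}.
Local Notation cell_of c := (open_cell (tagged (c : cells))).

(** The finite subcomplexes, in the form that allows induction on the number of
    cells. *)
Inductive built : set cells -> Prop :=
| built0 : built set0
| built_attach F k (e : cell W k) : built F -> ~ F (existT _ k e) ->
    [set cell_map e y | y in sphere R k] `<=` body F ->
    built (existT _ k e |` F).

Lemma body_attach F k (e : cell W k) :
  [set cell_map e y | y in sphere R k] `<=` body F ->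
  body (existT _ k e |` F) = body F `|` closed_cell e.
Proof.
move=> eF; apply/seteqP; split=> [x [c [->|Fc] cx]|x [[c Fc cx]|[y /disk_split[yD|Sy] <-]]].
- right; case: cx => y yD <-; exists y => //; exact: open_disk_disk.
- by left; exists c.
- by exists c => //; right.
- by exists (existT _ k e); [left|exists y].
- by have [|c Fc cy] := eF (cell_map e y); [exists y|exists c => //; right].
Qed.

Lemma built_closed F : built F -> closed (body F).
Proof.
elim=> [|{}F k e _ Fcl _ eF]; first by rewrite /body bigcup_set0; exact: closed0.
rewrite body_attach//; apply: closedU => //.
apply: compact_closed; first exact: cw_hausdorff W.
apply: continuous_compact; [exact: cell_map_continuous|exact: disk_compact].
Qed.

Lemma bodyS (F G : set cells) : F `<=` G -> body F `<=` body G.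
Proof. by move=> FG x [c Fc cx]; exists c => //; exact: FG. Qed.

Lemma built_union F G : built F -> built G ->
  exists2 E, built E & F `<=` E /\ G `<=` E.
Proof.
move=> bF; elim=> [|{}G k e _ [E bE [FE GE]] _ eG]; first by exists F => //; split=> // c [].
have [Ee|Ee] := pselect (E (existT _ k e)).
  by exists E => //; split=> // c [->|/GE].
exists (existT _ k e |` E).
  by apply: built_attach => //; apply: subset_trans eG _; exact: bodyS.
by split=> [c /FE ?|c [->|/GE ?]]; [right|left|right].
Qed.

Lemma built_finite_union (G : set cells) : finite_set G ->
  (forall c, G c -> exists2 F, built F & F c) -> exists2 F, built F & G `<=` F.
Proof.
move=> /(@finite_seqP {classic cells})[s ->]; elim: s => [_|c s IH bs].
  by exists set0 => //; exact: built0.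
have [F bF sF] : exists2 F : set cells, built F & [set` s] `<=` F.
  by apply: IH => d ds; apply: bs; rewrite /= inE ds orbT.
have [G' bG Gc] : exists2 F : set cells, built F & F c.
  by apply: bs; rewrite /= inE eqxx.
have [E bE [FE GE]] := built_union bF bG.
exists E => // d; rewrite /= inE => /orP[/eqP->|ds]; first exact: GE.
by apply: FE; exact: sF.
Qed.

(** By induction on the dimension: the boundary of a cell is covered by finitely many
    cells of lower dimension. *)
Lemma built_cell k (e : cell W k) : exists2 F, built F & F (existT _ k e).
Proof.
elim/ltn_ind: k e => k IH e.
have [G [Gf Gk] eG] := cw_closure_finite e.
have [F bF GF] : exists2 F, built F & G `<=` F.
  by apply: built_finite_union => // -[j c] Gc; apply: IH; exact: (Gk _ Gc).
have [Fe|Fe] := pselect (F (existT _ k e)); first by exists F.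
exists (existT _ k e |` F); last by left.
by apply: built_attach => //; apply: subset_trans eG _; exact: bodyS.
Qed.

Lemma same_cell (c d : cells) x : cell_of c x -> cell_of d x -> c = d.
Proof. by case: c d => [k e] [k' e'] /= cx dx; exact: cells_disjoint cx dx. Qed.

(** A set of points of the path, one in each of the cells that it meets, has only
    closed subsets, by the weak topology; as the path is compact, it is finite. *)
Lemma path_in_built (sigma : R -> X) : continuous sigma ->
  exists2 F, built F & forall u, 0 <= u <= 1 -> body F (sigma u).
Proof.
move=> sc; pose K := [set sigma u | u in `[0 : R, 1]%classic].
have /choice[c cP] x : exists d : cells, cell_of d x.
  by have [k [e ex]] := cells_cover W x; exists (existT _ k e).
(* The chosen point of the path in the cell [d], if there is one. *)
pose rep (d : cells) := xget (sigma 0) (K `&` cell_of d).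
have repP x : K x -> K (rep (c x)) /\ cell_of (c x) (rep (c x)).
  by move=> Kx; rewrite /rep; case: xgetP => [y -> []//|/(_ x)[]].
pose S := [set rep (c x) | x in K].
(* A closed cell meets finitely many open cells, each with one point of [S]. *)
have S_closed (S' : set X) : S' `<=` S -> closed S'.
  move=> S'S; apply: (cw_weak (c := W)) => k e.
  have [G [Gf _] eG] := cw_closure_finite e.
  apply: compact_closed; first exact: cw_hausdorff W.
  apply: finite_compact.
  apply: (@sub_finite_set _ _ [set rep d | d in existT _ k e |` G]).
    move=> x [/S'S[y Ky <-]] [w /disk_split wD wx].
    have [_ cy] := repP _ Ky; exists (c y) => //.
    case: wD => [wD|Sw].
      by left; apply: (same_cell cy); rewrite /=; exists w.
    have [|d Gd dx] := eG (rep (c y)); first by exists w.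
    by right; rewrite (same_cell cy dx).
  apply: finite_image; rewrite finite_setU; split=> //; exact: finite_set1.
have Sfin : finite_set S.
  have := @segment_compact R 0 1; rewrite compact_cover.
  move=> /(_ X S (fun x => sigma @^-1` (~` (S `\ x))))[x _| |].
  - apply: open_comp; first by move=> ? _; exact: sc.
    by apply: closed_openC; apply: S_closed => y [].
  - move=> u u01; have Ku : K (sigma u) by exists u.
    exists (rep (c (sigma u))); first by exists (sigma u).
    move=> [[y Ky yu]]; apply; rewrite -yu; congr rep.
    have [_ cy] := repP _ Ky; rewrite yu in cy.
    by rewrite yu; exact: same_cell cy (cP _).
  move=> D' _ D'c; apply: sub_finite_set (finite_fset D').
  move=> x Sx; have [y Ky yx] := Sx.
  have [[u u01 ux] _] := repP _ Ky.
  have [d dD' ud] := D'c u u01.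
  rewrite (_ : x = d)//; apply: contrapT => xd; apply: ud; rewrite ux yx.
  by split.
have [F bF cF] : exists2 F, built F & [set c x | x in S] `<=` F.
  apply: built_finite_union; first exact: finite_image.
  by move=> [k e] _; exact: built_cell.
exists F => // u u01; have Ku : K (sigma u) by exists u; rewrite //= in_itv.
exists (c (sigma u)); last exact: cP.
have [_ cr] := repP _ Ku.
rewrite (same_cell cr (cP _)); apply: cF.
by exists (rep (c (sigma u))) => //; exists (sigma u).
Qed.

End FiniteSubcomplexes.

(** * Cycles *)

Section SimplexPath.
Variables (R : realType) (X : topologicalType).

Definition interval_vec (u : R) : 'rV[R]_2 :=
  \row_j if j == ord_max then clamp u else 1 - clamp u.

Lemma interval_vec_simplex u : interval_vec u \in @std_simplex R 1.
Proof.
rewrite inE; split=> [j|].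
  by rewrite mxE; case: ifP => _; rewrite ?clamp_ge0// subr_ge0 clamp_le1.
by rewrite big_ord_recl big_ord1 !mxE /= subrK.
Qed.

Definition interval_pt (u : R) : @std_simplex R 1 :=
  exist _ (interval_vec u) (interval_vec_simplex u).

Lemma interval_pt_continuous : continuous interval_pt.
Proof.
apply: continuous_comp_initial => u A [P nP sPA].
suff : \forall v \near u, A (interval_vec v) by [].
have H0 : \forall v \near u, P 0 ord0 (1 - clamp v).
  have : (1 - clamp v) @[v --> u] --> 1 - clamp u.
    by apply: cvgB; [exact: cvg_cst|exact: clamp_continuous].
  by apply; have := nP 0 ord0; rewrite /= /sval /= mxE.
have H1 : \forall v \near u, P 0 ord_max (clamp v).
  by apply: clamp_continuous; have := nP 0 ord_max; rewrite /= /sval /= mxE.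
near=> v; apply: sPA => i j; rewrite (ord1 i) mxE.
have [->|] := eqVneq j ord_max; first by near: v.
move=> j1; rewrite (_ : j = ord0); first by near: v.
by case: j j1 => -[|[|]]//= ? _; exact/val_inj.
Unshelve. all: by end_near. Qed.

Lemma interval_pt_coord (t : @std_simplex R 1) : interval_pt (coord ord_max t) = t.
Proof.
apply/val_inj/rowP => j /=; rewrite mxE clamp_id ?coord_ge0 ?coord_le1//.
have [->//|j1] := eqVneq j ord_max.
rewrite -(coord_sum t) big_ord_recl big_ord1.
rewrite (_ : fintype.lift _ _ = ord_max) ?addrK; last exact/val_inj.
by rewrite (_ : j = ord0)//; case: j j1 => -[|[|]]//= ? _; exact/val_inj.
Qed.

Lemma interval_pt_clamp u : interval_pt (clamp u) = interval_pt u.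
Proof.
by apply/val_inj/rowP => j /=; rewrite !mxE [clamp (clamp u)]clamp_id// clamp_ge0 clamp_le1.
Qed.

Variable s : continuousType (@std_simplex R 1) X.

Definition simplex_path (u : R) : X := s (interval_pt u).

Lemma simplex_path_continuous : continuous simplex_path.
Proof. exact: (continuous_compose interval_pt_continuous (@cts_fun _ _ s)). Qed.

Lemma phi_simplex (Q : zmodType) (phi : {additive chains R X 1 -> Q}) :
  phi << s >> = path_class phi simplex_path.
Proof.
by apply: (path_classE _ simplex_path_continuous) => t; rewrite /simplex_path interval_pt_coord.
Qed.

Lemma simplex_path_face (t : @std_simplex R 0) :
  s (face ord0 t) = simplex_path 1 /\ s (face ord_max t) = simplex_path 0.
Proof.
have t1 : coord ord0 t = 1 by rewrite -(coord_sum t) big_ord1.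
by split; congr (s _); rewrite -[LHS]interval_pt_coord; congr interval_pt;
  rewrite coord_face ?unlift_none// (_ : ord_max = fintype.lift ord0 ord0) ?liftK//; exact/val_inj.
Qed.

End SimplexPath.

Section Cycles.
Variables (R : realType) (X : topologicalType) (Q : zmodType).
Variable (phi : {additive chains R X 1 -> Q}).
Hypothesis phiB : forall b, phi (@boundary R X 1 b) = 0.
Variable (W : cw_complex R X).
Hypothesis edges : forall e : cell W 1,
  path_class phi (seg (chi e) (const_mx (-1)) (const_mx 1)) = 0.

Lemma built_potential F : built F -> exists g, potential (W := W) phi F g.
Proof.
elim=> [|{}F k e bF [g gF] Fe eF].
  by exists (fun=> 0); split=> // sigma _ /(_ 0)[].
have [c cE c0] := attaching_constant phiB edges gF eF.
exists (extension phi g e c).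
exact: (extension_potential phiB gF (built_closed bF) Fe eF cE c0).
Qed.

Definition vertex_pt : @std_simplex R 0.
Proof.
exists (const_mx 1); rewrite inE; split=> [i|]; first by rewrite mxE ler01.
by rewrite big_ord1 mxE.
Defined.

Section Lift.
Variable g : X -> Q.
(** [zmodule Q] is [Q] as a module over the integers, the kind of target to which a
    function extends linearly from simplices to chains. *)
Definition vertex_value (s : continuousType (@std_simplex R 0) X) : (zmodule Q) :=
  g (s vertex_pt).
Definition vertex_lift : chains R X 0 -> (zmodule Q) := fglift vertex_value.
HB.instance Definition _ := GRing.isZmodMorphism.Build (chains R X 0) (zmodule Q)
  vertex_lift (lift_is_additive vertex_value).

Lemma vertex_lift_boundary (s : continuousType (@std_simplex R 1) X) :
  vertex_lift (boundary << s >>) =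
  g (simplex_path s 1) - g (simplex_path s 0) :> Q.
Proof.
rewrite /boundary liftU scale1r /boundary_simplex big_ord_recl big_ord1.
rewrite expr0 expr1 scale1r scaleN1r raddfB /= /vertex_lift !liftU !scale1r.
rewrite /vertex_value /=.
have [-> _] := simplex_path_face s vertex_pt.
rewrite (_ : fintype.lift _ _ = ord_max); last exact/val_inj.
by have [_ ->] := simplex_path_face s vertex_pt.
Qed.

End Lift.

(** On a finite subcomplex that contains [z], the map [phi] is the composite of the
    boundary with the linear extension of a potential. *)
Lemma phi_cycle (z : chains R X 1) : boundary z = 0 -> phi z = 0.
Proof.
move=> z0.
have [F bF zF] : exists2 F : set {j & cell W j}, built F &
    forall s, s \in dom z -> forall u, body F (simplex_path s u).
  elim: (dom z) => [|s l [F bF lF]]; first by exists set0 => //; exact: built0.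
  have [G bG sG] := path_in_built W (@simplex_path_continuous _ _ s).
  have [E bE [FE GE]] := built_union bF bG.
  exists E => // t; rewrite inE => /orP[/eqP->|/lF tF] u; last exact: bodyS FE _ (tF u).
  rewrite /simplex_path -interval_pt_clamp; apply: (bodyS GE).
  by apply: sG; rewrite clamp_ge0 clamp_le1.
have [g [_ gF]] := built_potential bF.
suff -> : phi z = vertex_lift g (boundary z) by rewrite z0 raddf0.
rewrite -[in LHS](freeg_sumE z) -[in RHS](freeg_sumE z) !raddf_sum.
rewrite big_seq [RHS]big_seq; apply: eq_bigr => s sz.
rewrite -[freeg.coeff s z]intz -freegU_mulz !raddfMz; congr (_ *~ _).
rewrite phi_simplex [RHS]vertex_lift_boundary; apply: gF; last exact: zF.
exact: simplex_path_continuous.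
Qed.

End Cycles.

(** * Finitely generated abelian groups *)

Definition additive_of (U V : zmodType) (f : U -> V)
    (fB : {morph f : x y / x - y}) : {additive U -> V} :=
  HB.pack f (GRing.isZmodMorphism.Build U V f fB).

Section Combinations.
Variable K : zmodType.

Definition lincomb m (v : 'I_m -> K) (c : 'cV[int]_m) : K := \sum_i v i *~ c i 0.

Definition span m (v : 'I_m -> K) : set K := range (lincomb v).

Definition fg : Prop := exists m (v : 'I_m -> K), forall x, span v x.

Lemma lincombB m (v : 'I_m -> K) : {morph lincomb v : c d / c - d}.
Proof.
move=> c d; rewrite /lincomb -sumrB; apply: eq_bigr => i _.
by rewrite !mxE mulrzBr.
Qed.

Definition lincomb_additive m (v : 'I_m -> K) : {additive 'cV[int]_m -> K} :=
  additive_of (lincombB v).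

Lemma lincomb0 m (v : 'I_m -> K) : lincomb v 0 = 0.
Proof. exact: (raddf0 (lincomb_additive v)). Qed.

Lemma lincomb_delta m (v : 'I_m -> K) i : lincomb v (delta_mx i 0) = v i.
Proof.
rewrite /lincomb (bigD1 i) //= big1 => [|j ji]; rewrite mxE ?eqxx ?(negPf ji) ?mulr0z//.
by rewrite mulr1z addr0.
Qed.

Lemma subgroup_mulz (S : set K) x c : is_subgroup S -> S x -> S (x *~ c).
Proof.
move=> [S0 SB] Sx.
have SN y : S y -> S (- y) by move=> Sy; rewrite -sub0r; exact: SB.
have SM n : S (x *+ n).
  elim: n => [|n IH]; first by rewrite mulr0n.
  by rewrite mulrS -[x *+ n]opprK; apply: SB => //; exact: SN.
by case: c => n; [exact: SM|rewrite NegzE mulrNz; apply: SN; exact: SM].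
Qed.

Lemma subgroup_add (S : set K) x y : is_subgroup S -> S x -> S y -> S (x + y).
Proof.
by move=> [S0 SB] Sx Sy; rewrite -[y]opprK; apply: (SB) => //; rewrite -sub0r; exact: SB.
Qed.

Lemma subgroup_lincomb (S : set K) m (v : 'I_m -> K) c :
  is_subgroup S -> (forall i, S (v i)) -> S (lincomb v c).
Proof.
move=> Ssub Sv; rewrite /lincomb; elim/big_rec: _ => [|i x _ Sx]; first exact: Ssub.1.
by apply: subgroup_add => //; exact: subgroup_mulz.
Qed.

Lemma span_subgroup m (v : 'I_m -> K) : is_subgroup (span v).
Proof.
split; first by exists 0 => //; exact: lincomb0.
by move=> _ _ [c _ <-] [d _ <-]; exists (c - d) => //; rewrite lincombB.
Qed.

Lemma span_mem m (v : 'I_m -> K) i : span v (v i).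
Proof. by exists (delta_mx i 0) => //; exact: lincomb_delta. Qed.

Lemma lincomb_recr m (v : 'I_m.+1 -> K) c :
  lincomb v c = lincomb (v \o widen_ord (leqnSn m)) (\col_i c (widen_ord (leqnSn m) i) 0)
    + v ord_max *~ c ord_max 0.
Proof.
by rewrite /lincomb big_ord_recr /=; congr (_ + _); apply: eq_bigr => i _; rewrite mxE.
Qed.

(** The ideal of the last coefficients is principal; a member with a generating
    last coefficient and the members with last coefficient zero generate. *)
Lemma subgroup_fg m (v : 'I_m -> K) (S : set K) : is_subgroup S -> S `<=` span v ->
  exists k (w : 'I_k -> K), (forall i, S (w i)) /\ S `<=` span w.
Proof.
elim: m v S => [|m IH] v S Ssub Sv.
  by exists 0%N, v; split=> [[]|].
pose v' := v \o widen_ord (leqnSn m).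
have IH' : exists k (w : 'I_k -> K), (forall i, S (w i)) /\ S `&` span v' `<=` span w.
  have sub' : is_subgroup (S `&` span v').
    have [s0 sB] := span_subgroup v'; split; first by split=> //; exact: Ssub.1.
    by move=> x y [Sx vx] [Sy vy]; split; [exact: Ssub.2|exact: sB].
  have [k [w [Sw wS]]] := IH v' _ sub' (@subIsetr _ _ _).
  by exists k, w; split=> // i; case: (Sw i).
have [[c [Sc c0]]|none] := pselect (exists c, S (lincomb v c) /\ c ord_max 0 != 0); last first.
  have [k [w [Sw wS]]] := IH'; exists k, w; split=> // x Sx; apply: wS; split=> //.
  have [c _ cx] := Sv _ Sx; rewrite -cx lincomb_recr.
  have [->|c0] := eqVneq (c ord_max 0) 0; last by exfalso; apply: none; exists c; rewrite cx.
  by rewrite mulr0z addr0; eexists.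
pose P n := `[< exists c, [/\ S (lincomb v c), c ord_max 0 != 0 & absz (c ord_max 0) = n] >].
have exP : exists n, P n by exists (absz (c ord_max 0)); apply/asboolP; exists c.
case: (ex_minnP exP) => n /asboolP[{c0}d [Sd d0 dn]] nmin.
have [k [w [Sw wS]]] := IH'.
pose w' (i : 'I_k.+1) := if unlift ord_max i is Some j then w j else lincomb v d.
have Sw' i : S (w' i) by rewrite /w'; case: unliftP.
exists k.+1, w'; split=> // x Sx.
have [a _ ax] := Sv _ Sx.
pose q := divz (a ord_max 0) (d ord_max 0).
have Sxq : S (x - lincomb v d *~ q) by apply: Ssub.2 => //; exact: subgroup_mulz.
have xqE : x - lincomb v d *~ q = lincomb v (a - d *~ q).
  by rewrite lincombB ax -(raddfMz (lincomb_additive v)).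
pose l := (a - d *~ q) ord_max 0.
have lastE : l = modz (a ord_max 0) (d ord_max 0).
  by rewrite /l -scaler_int !mxE intz.
have r0 : l = 0.
  apply/eqP; apply: contraT => l0.
  have : (n <= absz l)%N.
    by apply: nmin; apply/asboolP; exists (a - d *~ q); rewrite -xqE.
  by rewrite -dn leqNgt -ltz_nat !abszE lastE ger0_norm ?modz_ge0// ltz_mod.
have [b _ bx] : span w (x - lincomb v d *~ q).
  apply: wS; split=> //; rewrite xqE lincomb_recr -/l r0 mulr0z addr0; by eexists.
have -> : x = lincomb w b + lincomb v d *~ q by rewrite bx subrK.
apply: subgroup_add; first exact: span_subgroup.
  apply: subgroup_lincomb; first exact: span_subgroup.
  move=> i; rewrite (_ : w i = w' (fintype.lift ord_max i)); first exact: span_mem.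
  by rewrite /w' liftK.
apply: subgroup_mulz; first exact: span_subgroup.
by rewrite (_ : lincomb v d = w' ord_max); [exact: span_mem|rewrite /w' unlift_none].
Qed.

End Combinations.

Lemma raddf_lincomb (K B : zmodType) (f : {additive K -> B}) m (v : 'I_m -> K) c :
  f (lincomb v c) = lincomb (f \o v) c.
Proof. by rewrite /lincomb raddf_sum; apply: eq_bigr => i _; rewrite raddfMz. Qed.

Lemma fg_epi (K B : zmodType) (f : {additive K -> B}) : epi f -> fg K -> fg B.
Proof.
move=> fe [m [v vK]]; exists m, (f \o v) => b.
have [x <-] := fe b; have [c _ <-] := vK x.
by exists c => //; rewrite raddf_lincomb.
Qed.

(** * Finite generation of the first homology group *)

Lemma quotmap_eq0 (V : zmodType) (S : zmodClosed V) x :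
  (quotmap S x = 0) <-> (x \in S).
Proof.
have q0 : quotmap S 0 = 0 := raddf0 _.
have := Quotient.idealrBE S x 0; rewrite subr0 => ->.
split=> [xS|/eqP xS]; last by rewrite -q0; exact: xS.
by apply/eqP; change (quotmap S x = quotmap S 0); rewrite xS q0.
Qed.

Lemma quotmap_epi (V : zmodType) (S : zmodClosed V) : epi (quotmap S).
Proof. by move=> b; exists (repr b); rewrite /= reprK. Qed.

Section SumSubgroup.
Variables (V U : zmodType) (f : {additive U -> V}) (m : nat) (v : 'I_m -> V).

Definition im_plus_span : {pred V} :=
  fun x => `[< exists b c, x = f b + lincomb v c >].

Lemma im_plus_span_zmod_closed : zmod_closed im_plus_span.
Proof.
split=> [|x y]; rewrite !unfold_in.
  apply/asboolP; exists 0, 0; rewrite raddf0 add0r.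
  by rewrite lincomb0.
move=> /asboolP[b [c ->]] /asboolP[b' [c' ->]]; apply/asboolP.
by exists (b - b'), (c - c'); rewrite raddfB lincombB opprD addrACA.
Qed.

HB.instance Definition _ := GRing.isZmodClosed.Build V im_plus_span
  im_plus_span_zmod_closed.
End SumSubgroup.

(** By [phi_cycle], applied to the quotient map by the sum of the boundaries and the
    span of the finitely many edges, a cycle is the sum of a boundary and of a
    combination of edges. The combinations that occur form a subgroup of [Z^m], which
    is finitely generated. *)
Lemma H1_fg (R : realType) (X : topologicalType) (W : cw_complex R X) :
  finite_1skeleton W -> fg (H1 R X).
Proof.
move=> /(@finite_seqP {classic {k & cell W k}})[s sE].
pose m := size s.
pose edge (i : 'I_m) : {k & cell W k} := tnth (in_tuple s) i.
pose v (i : 'I_m) : chains R X 1 :=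
  << path_simplex (@continuous_seg R X _ _ (@chi_continuous R X W _ (tagged (edge i)))
      (const_mx (-1)) (const_mx 1)) >>.
pose S := im_plus_span (@boundary R X 1) v.
have cycleS z : boundary z = 0 -> z \in S.
  move=> z0; apply/(quotmap_eq0 S).
  apply: (@phi_cycle R X _ (quotmap S) _ W) => // [b|e].
    apply/quotmap_eq0; rewrite unfold_in; apply/asboolP; exists b, 0.
    by rewrite lincomb0 addr0.
  have es : existT _ 1%N e \in s.
    have : [set` s] (existT (cell W) 1%N e) by rewrite -sE.
    by [].
  have [i iE] := @tnthP _ _ (in_tuple s) _ es.
  have -> : path_class (quotmap S) (seg (chi e) (const_mx (-1)) (const_mx 1)) = quotmap S (v i).
    apply/esym/path_classE; last by move=> t; rewrite /= /mkcts /edge -iE.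
    exact: (continuous_seg (@chi_continuous _ _ _ _ e)).
  apply/quotmap_eq0; rewrite unfold_in; apply/asboolP; exists 0, (delta_mx i 0).
  by rewrite lincomb_delta raddf0 add0r.
pose L := [set c : 'cV[int]_m | exists b, boundary (@boundary R X 1 b + lincomb v c) = 0].
have Lsub : is_subgroup L.
  split=> [|c d [b Lc] [b' Ld]].
    by exists 0; rewrite lincomb0 raddf0 addr0 raddf0.
  by exists (b - b'); rewrite lincombB raddfB /= addrACA -opprD raddfB /= Lc Ld subrr.
have [k [w [Lw wL]]] : exists k (w : 'I_k -> 'cV[int]_m), (forall i, L (w i)) /\ L `<=` span w.
  apply: (subgroup_fg (v := fun i : 'I_m => delta_mx i 0)) => // c _.
  exists c => //; rewrite /lincomb [RHS]matrix_sum_delta.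
  by apply: eq_bigr => i _; rewrite big_ord1 -scaler_int intz.
have [b bw] := choice Lw.
pose z_ i := boundary (b i) + lincomb v (w i).
have cyc i : z_ i \in ker_pred (@boundary R X 0).
  by rewrite unfold_in; apply/eqP; exact: bw.
pose zc (i : 'I_k) : cycles R X 0 := exist _ (z_ i) (cyc i).
exists k, (fun i => quotmap (@bounding R X 0) (zc i)) => x.
have [z <-] := quotmap_epi x.
have z0 : boundary (val z) = 0 by have := valP z; rewrite unfold_in => /eqP.
have := cycleS _ z0; rewrite unfold_in => /asboolP[b' [c zE]].
have Lc : L c by exists b'; rewrite -zE.
have [d _ dc] := wL _ Lc.
exists d => //; rewrite -[LHS](raddf_lincomb (quotmap (@bounding R X 0)) zc).
apply/eqP; rewrite -subr_eq0 -raddfB; apply/eqP/quotmap_eq0.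
rewrite unfold_in /bounding unfold_in; apply/asboolP.
exists (lincomb b d - b').
have E1 : boundary (lincomb b d) = lincomb (fun i => boundary (b i)) d.
  exact: (raddf_lincomb (@boundary R X 1 : {additive _ -> _})).
have E2 : val (lincomb zc d) = lincomb z_ d.
  exact: (raddf_lincomb (val : {additive cycles R X 0 -> chains R X 1})).
have E3 : lincomb v (lincomb w d) = lincomb (fun i => lincomb v (w i)) d.
  exact: (raddf_lincomb (lincomb_additive v)).
rewrite !raddfB /= E1 E2 zE -dc E3.
rewrite opprD addrA [RHS]addrAC; congr (_ - _).
apply/eqP; rewrite eq_sym subr_eq; apply/eqP.
by rewrite /lincomb -big_split /=; apply: eq_bigr => i _; rewrite -mulrzDl.
Qed.

(** * Free and torsion part *)

Lemma cV_lincomb m (c : 'cV[int]_m) : c = lincomb (fun i => delta_mx i 0) c.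
Proof.
rewrite [LHS]matrix_sum_delta /lincomb; apply: eq_bigr => i _.
by rewrite big_ord1 -scaler_int intz.
Qed.

Lemma additive_lincomb (K : zmodType) m (f : {additive 'cV[int]_m -> K}) c :
  f c = lincomb (fun i => f (delta_mx i 0)) c.
Proof. by rewrite [in LHS](cV_lincomb c) raddf_lincomb. Qed.

(** The Smith normal form of a column. *)
Lemma smith_col m (c : 'cV[int]_m.+1) : exists2 L, L \in unitmx &
  exists d : int, c = d *: col 0 L.
Proof.
have [L Lu [R Ru [d _ cE]]] := int_Smith_normal_form c.
exists L => //; exists (d`_0 * R 0 0).
rewrite cE; apply/colP => i; rewrite mxE big_ord1 !mxE (bigD1 0) //= big1 => [|j j0].
  by rewrite !mxE eqxx mulr1n addr0 -mulrA mulrC.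
by rewrite !mxE [_ == _](negPf j0) mulr0n mulr0.
Qed.

(** More columns than entries are dependent: the last column of the Smith form
    vanishes. *)
Lemma cV_dependent m (x : 'I_m.+1 -> 'cV[int]_m) :
  exists2 c : 'cV[int]_m.+1, c != 0 & lincomb x c = 0.
Proof.
pose M : 'M[int]_(m, m.+1) := \matrix_(i, j) x j i 0.
have [L Lu [R Ru [d _ ME]]] := int_Smith_normal_form M.
exists (invmx R *m delta_mx ord_max 0).
  apply: contraTneq isT => E.
  have : R *m (invmx R *m (delta_mx ord_max 0 : 'cV_m.+1)) = 0 by rewrite E mulmx0.
  rewrite mulmxA mulmxV// mul1mx => /matrixP/(_ ord_max 0).
  by rewrite !mxE !eqxx => /eqP; rewrite oner_eq0.
have lM c : lincomb x c = M *m c.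
  rewrite /lincomb; apply/colP => i; rewrite summxE mxE; apply: eq_bigr => j _.
  by rewrite -scaler_int intz !mxE mulrC.
rewrite lM ME -mulmxA mulmxA -mulmxA (mulmxA R) mulmxV// mul1mx -mulmxA.
rewrite (_ : _ *m delta_mx _ _ = 0) ?mulmx0//.
apply/colP => i; rewrite !mxE (bigD1 ord_max) //= big1 => [|j j0].
  by rewrite !mxE (ltn_eqF (ltn_ord i)) mulr0n mul0r addr0.
by rewrite !mxE (negPf j0) mulr0.
Qed.

Section Split.
Variable K : zmodType.

Lemma torsionP (x : K) : x \in torsion K <-> exists2 N, (0 < N)%N & x *+ N = 0.
Proof. by rewrite unfold_in; split=> /asboolP. Qed.

Lemma torsion_mulz (x : K) (d : int) : d != 0 -> x *~ d = 0 -> x \in torsion K.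
Proof.
move=> d0 xd; apply/torsionP; exists (absz d); first by rewrite absz_gt0.
case: d d0 xd => n _ //=; rewrite NegzE mulrNz => /eqP; rewrite oppr_eq0 => /eqP.
by [].
Qed.

(** Take a family of least size that generates [K] modulo torsion. A relation
    between its members would, after a change of basis, be a relation [u *~ d = 0]
    for a single member [u] of the new family, which could then be dropped. So the
    coefficients of an element modulo torsion are unique; they define [p]. *)
Lemma fg_split : fg K -> exists k (p : {additive K -> 'cV[int]_k})
  (s : {additive 'cV[int]_k -> K}), cancel s p /\
  forall x, p x = 0 <-> x \in torsion K.
Proof.
move=> [m0 [v0 v0K]].
pose P m := `[< exists v : 'I_m -> K, forall x, exists c, x - lincomb v c \in torsion K >].
have exP : exists m, P m.
  exists m0; apply/asboolP; exists v0 => x; have [c _ <-] := v0K x.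
  by exists c; rewrite subrr rpred0.
case: (ex_minnP exP) => k /asboolP[v vK] kmin.
have indep c : lincomb v c = 0 -> c = 0.
  move=> vc; apply/eqP; apply: contraT => c0; exfalso.
  case: k v vK kmin c vc c0 => [|k] v vK kmin c vc c0.
    by move: c0; rewrite (_ : c = 0) ?eqxx//; apply/colP => -[].
  have [L Lu [d cE]] := smith_col c.
  have d0 : d != 0 by apply: contraNneq c0 => d0; rewrite cE d0 scale0r.
  have : (k.+1 <= k)%N; last by rewrite ltnn.
  apply: kmin; apply/asboolP.
  exists (fun i => lincomb v (col (fintype.lift ord0 i) L)) => x.
  have [a xa] := vK x.
  pose b := invmx L *m a.
  have aE : a = lincomb (fun j => col j L) b.
    rewrite -[LHS](mulKVmx Lu) -/b; apply/colP => i; rewrite mxE /lincomb summxE.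
    by apply: eq_bigr => j _; rewrite -scaler_int intz !mxE mulrC.
  clearbody b; have T0 : lincomb v (col 0 L) \in torsion K.
    apply: (torsion_mulz d0); rewrite -[LHS](raddfMz (lincomb_additive v)).
    by rewrite -scaler_int intz -cE.
  exists (\col_i b (fintype.lift ord0 i) 0).
  have E : lincomb v a = lincomb v (col 0 L) *~ b 0 0 +
    lincomb (fun i => lincomb v (col (fintype.lift ord0 i) L)) (\col_i b (fintype.lift ord0 i) 0).
    rewrite {1}aE [LHS](raddf_lincomb (lincomb_additive v)) /lincomb big_ord_recl; congr (_ + _).
    by apply: eq_bigr => i _; rewrite mxE.
  have := rpredD xa (rpredMz (b 0 0) T0).
  by rewrite E opprD addrA addrAC subrK.
have uniq c d : lincomb v c - lincomb v d \in torsion K -> c = d.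
  rewrite -lincombB => /torsionP[N N0]; rewrite -[LHS](raddfMn (lincomb_additive v)) => /indep.
  move=> /matrixP E; apply/eqP; rewrite -subr_eq0; apply/eqP/colP => i.
  have := E i 0; rewrite mulmxnE [RHS]mxE => /eqP.
  by rewrite mulrn_eq0 eqn0Ngt N0 /= => /eqP ->; rewrite mxE.
have [p pE] := choice vK.
have uniq' x c d : x - lincomb v c \in torsion K -> x - lincomb v d \in torsion K -> c = d.
  move=> xc xd; apply: uniq; have := rpredB xd xc.
  by rewrite opprB addrC addrA subrK.
have pB : {morph p : x y / x - y}.
  move=> x y; apply: (uniq' (x - y)) => //.
  by rewrite lincombB opprD addrACA -opprD rpredB.
exists k, (additive_of pB), (lincomb_additive v); split=> [c|x] /=.
  by apply: (uniq' (lincomb v c)) => //; rewrite subrr rpred0.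
split=> [px|xT]; first by have := pE x; rewrite px lincomb0 subr0.
by apply: (uniq' x) => //; rewrite lincomb0 subr0.
Qed.

End Split.

(** * Ranks, finiteness and bases *)

Lemma additive_ext (U V : zmodType) (f g : {additive U -> V}) : f =1 g -> f = g.
Proof.
case: f g => f [[fN]] [g [[gN]]] /= /funext fg; subst g.
by rewrite (Prop_irrelevance fN gN).
Qed.

Section Rank.
Variable K : zmodType.

Lemma ZindepP m (v : 'I_m -> K) :
  Zindep v <-> (forall c, lincomb v c = 0 -> c = 0).
Proof.
split=> [vi c /vi ci|vi c vc i]; first by apply/colP => i; rewrite ci mxE.
have /colP/(_ i) : \col_j c j = 0.
  by apply: vi; rewrite -[RHS]vc; apply: eq_bigr => j _; rewrite mxE.
by rewrite !mxE.
Qed.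

Lemma Zindep_inj m k (h : 'I_k -> 'I_m) (v : 'I_m -> K) :
  injective h -> Zindep v -> Zindep (v \o h).
Proof.
move=> hi /ZindepP vi; apply/ZindepP => c vhc.
pose d := lincomb (fun j => delta_mx (h j) (0 : 'I_1) : 'cV[int]_m) c.
have d0 : d = 0.
  apply: vi; rewrite [LHS](raddf_lincomb (lincomb_additive v)) -vhc.
  by apply: eq_bigr => j _; rewrite /= lincomb_delta.
apply/colP => i; rewrite mxE.
have := congr1 (fun M : 'cV[int]_m => M (h i) 0) d0.
rewrite mxE /d /lincomb summxE (bigD1 i) //= big1 => [|j ji].
  by rewrite addr0 -scaler_int intz !mxE !eqxx mulr1.
by rewrite -scaler_int intz !mxE eq_sym (inj_eq hi) (negPf ji) mulr0.
Qed.

Lemma has_rank_unique (S : set K) m k : has_rank S m -> has_rank S k -> m = k.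
Proof.
suff H a b : has_rank S a -> has_rank S b -> (a <= b)%N.
  by move=> Sm Sk; apply/eqP; rewrite eqn_leq !H.
move=> [[v vi vS] _] [_ nob]; rewrite leqNgt; apply/negP => ba.
apply: (nob (v \o widen_ord ba)) => [i|]; first exact: vS.
by apply: Zindep_inj vi => i j /(congr1 val) /= /val_inj.
Qed.

(** The images under [p] of [m.+1] elements satisfy a relation; the relation between
    the elements themselves holds up to torsion, and a multiple of it holds. *)
Lemma has_rankP (S : set K) m (p : {additive K -> 'cV[int]_m})
    (s : {additive 'cV[int]_m -> K}) : is_subgroup S ->
  (forall c, S (s c)) -> cancel s p ->
  (forall x, S x -> p x = 0 -> x \in torsion K) -> has_rank S m.
Proof.
move=> Ssub sS sK pS; split.
  exists (fun i => s (delta_mx i 0)) => //; apply/ZindepP => c.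
  by rewrite -additive_lincomb => sc; rewrite -[c]sK sc raddf0.
move=> v vS /ZindepP vi.
have [c c0 pc] := cV_dependent (p \o v).
have /torsionP[N N0 cN] : lincomb v c \in torsion K.
  by apply: pS; [exact: subgroup_lincomb|rewrite raddf_lincomb].
move: c0; rewrite -(raddfMn (lincomb_additive v)) /= in cN.
have /matrixP E := vi _ cN; case/eqP; apply/colP => i.
have := E i 0; rewrite mulmxnE [RHS]mxE => /eqP.
by rewrite mulrn_eq0 eqn0Ngt N0 /= => /eqP ->; rewrite mxE.
Qed.

Lemma rank_split k (p : {additive K -> 'cV[int]_k}) (s : {additive 'cV[int]_k -> K}) :
  cancel s p -> (forall x, p x = 0 <-> x \in torsion K) -> rank K = k.
Proof.
move=> sK pT; have rk : has_rank [set: K] k.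
  by apply: (has_rankP (p := p) (s := s)) => // x _ /pT.
by rewrite /rank; case: xgetP => [m _ mr|/(_ k)]//; exact: has_rank_unique mr rk.
Qed.

End Rank.

Section Finiteness.

(** Coefficients matter only modulo a common exponent of the generators. *)
Lemma finite_torsion_group (K : zmodType) :
  fg K -> (forall x, x \in torsion K) -> finite_set [set: K].
Proof.
move=> [m [v vK]] Ktors.
have /choice[N NP] i : exists N, (0 < N)%N /\ v i *+ N = 0.
  by have /torsionP[N N0 vN] := Ktors (v i); exists N.
pose M := (\prod_i N i)%N.-1.
have ME : M.+1 = (\prod_i N i)%N by rewrite prednK// prodn_gt0// => i; case: (NP i).
have vM i : v i *~ M.+1 = 0.
  by rewrite ME (bigD1 i) //= PoszM mulrzA -(pmulrn (v i)) (NP i).2 mul0rz.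
pose F (f : {ffun 'I_m -> 'I_M.+1}) := lincomb v (\col_i Posz (f i)).
apply: (@sub_finite_set _ _ (range F)); last exact/finite_image/finite_finset.
move=> x _; have [c _ <-] := vK x.
exists [ffun i => inord (absz (modz (c i 0) M.+1))] => //.
apply: eq_bigr => i _; rewrite mxE ffunE inordK; last first.
  by rewrite -ltz_nat abszE ger0_norm ?modz_ge0// ltz_pmod.
rewrite abszE ger0_norm ?modz_ge0// (_ : v i *~ c i 0 =
  v i *~ (divz (c i 0) M.+1 * M.+1 + modz (c i 0) M.+1)); last by rewrite -divz_eq.
by rewrite [RHS]mulrzDr mulrzA mulrzAC vM mul0rz add0r.
Qed.

Lemma finite_hom (K B : zmodType) : fg K -> finite_set [set: B] ->
  finite_set [set: {additive K -> B}].
Proof.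
move=> [m [v vK]] /finite_seqP[s sB].
pose code (f : {ffun 'I_m -> 'I_(size s)}) : set {additive K -> B} :=
  [set g | forall i, g (v i) = nth 0 s (f i)].
pose F f : {additive K -> B} :=
  if pselect (exists g, code f g) is left e then projT1 (cid e) else \0.
apply: (@sub_finite_set _ _ (range F)); last exact/finite_image/finite_finset.
move=> g _; have ind i : (index (g (v i)) s < size s)%N.
  rewrite index_mem; have : [set` s] (g (v i)) by rewrite -sB.
  by [].
exists [ffun i => Ordinal (ind i)] => //.
have cg : code [ffun i => Ordinal (ind i)] g.
  by move=> i; rewrite ffunE /= nth_index// -index_mem.
rewrite /F; case: pselect => [e|[]]; last by exists g.
case: cid => h ch /=.
apply: additive_ext => x; have [c _ <-] := vK x.
rewrite !raddf_lincomb; apply: eq_bigr => i _ /=.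
by rewrite ch cg.
Qed.

End Finiteness.

Section SubgroupOfSet.
Variables (V : zmodType) (S : set V) (Ssub : is_subgroup S).

Definition set_pred of is_subgroup S : {pred V} := fun x => `[< S x >].

Lemma set_pred_zmod_closed : zmod_closed (set_pred Ssub).
Proof.
split=> [|x y]; rewrite !unfold_in; first by apply/asboolP; exact: Ssub.1.
by move=> /asboolP Sx /asboolP Sy; apply/asboolP; exact: Ssub.2.
Qed.
HB.instance Definition _ := GRing.isZmodClosed.Build V (set_pred Ssub)
  set_pred_zmod_closed.

End SubgroupOfSet.

Lemma cV_torsion_free n (x : 'cV[int]_n) : x \in torsion _ -> x = 0.
Proof.
move=> /torsionP[N N0 /matrixP E]; apply/colP => i.
have := E i 0; rewrite mulmxnE [RHS]mxE => /eqP.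
by rewrite mulrn_eq0 eqn0Ngt N0 /= => /eqP ->; rewrite mxE.
Qed.

(** As a finitely generated group without torsion, [S] is free by [fg_split]. *)
Lemma subgroup_basis n (S : set 'cV[int]_n) : is_subgroup S ->
  exists k (B : 'M[int]_(n, k)), (forall x, S x <-> exists c, x = B *m c) /\
    forall c : 'cV_k, B *m c = 0 -> c = 0.
Proof.
move=> Ssub.
have [m [w [Sw wS]]] : exists k (w : 'I_k -> 'cV[int]_n), (forall i, S (w i)) /\ S `<=` span w.
  apply: (subgroup_fg (v := fun i : 'I_n => delta_mx i 0)) => // c _.
  by exists c => //; rewrite -cV_lincomb.
have mem x : S x -> x \in set_pred Ssub by move=> Sx; rewrite unfold_in; apply/asboolP.
have memP x : x \in set_pred Ssub -> S x by rewrite unfold_in => /asboolP.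
pose K := subgrp (set_pred Ssub).
pose vl : {additive K -> 'cV[int]_n} := val.
have Kfg : fg K.
  exists m, (fun i => exist _ (w i) (mem _ (Sw i)) : K) => x.
  have [c _ cx] := wS _ (memP _ (valP x)).
  by exists c => //; apply: val_inj; rewrite /= -[RHS]cx; exact: (raddf_lincomb vl).
have [k [p [s [sK pT]]]] := fg_split Kfg.
exists k, (\matrix_(i, j) val (s (delta_mx j 0)) i 0).
have BE c : (\matrix_(i, j) val (s (delta_mx j 0)) i 0) *m c = val (s c).
  rewrite additive_lincomb [RHS](raddf_lincomb vl); apply/colP => i.
  rewrite mxE /lincomb summxE; apply: eq_bigr => j _.
  by rewrite -scaler_int intz !mxE mulrC.
split=> [x|c].
  split=> [Sx|[c ->]]; last by rewrite BE; exact/memP/valP.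
  exists (p (exist _ x (mem _ Sx) : K)); rewrite BE.
  set y : K := exist _ x _; suff -> : s (p y) = y by [].
  apply/eqP; rewrite -subr_eq0; apply/eqP/val_inj.
  change (vl (s (p y) - y) = 0); apply: cV_torsion_free.
  have /torsionP[N N0 E] : s (p y) - y \in torsion K.
    by apply/pT; rewrite raddfB /= sK subrr.
  by apply/torsionP; exists N => //; rewrite -[LHS](raddfMn vl) E raddf0.
rewrite BE => sc; have : s c = 0 by apply: val_inj.
by move=> s0; rewrite -[c]sK s0 raddf0.
Qed.

(** * Parabolic subgroup and Grassmannian *)

Section Blocks.
Variables (n r : nat) (rn : (r <= n)%N).

Definition up_ord : 'I_(n - r) -> 'I_n := widen_ord (leq_subr r n).
Definition low_ord (j : 'I_r) : 'I_n := cast_ord (subnK rn) (rshift (n - r) j).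

(** The projections of [Z^n] to its first [n - r] and its last [r] coordinates. *)
Definition up : 'M[int]_(n - r, n) := rowsub up_ord 1%:M.
Definition low : 'M[int]_(r, n) := rowsub low_ord 1%:M.

Lemma up_ord_inj : injective up_ord.
Proof. by move=> i j /(congr1 val) /= /val_inj. Qed.

Lemma low_ord_inj : injective low_ord.
Proof. by move=> i j /cast_ord_inj/rshift_inj. Qed.

Lemma up_low_neq i j : (up_ord i == low_ord j) = false.
Proof.
apply/eqP => /(congr1 val) /= E; have := ltn_ord i.
by rewrite E ltnNge leq_addr.
Qed.

Lemma up_low_ord (a : 'I_n) : (exists i, a = up_ord i) \/ (exists j, a = low_ord j).
Proof.
have [an|an] := ltnP a (n - r).
  by left; exists (Ordinal an); exact: val_inj.
right; have ar : (a - (n - r) < r)%N by rewrite ltn_subLR// subnK.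
by exists (Ordinal ar); apply: val_inj; rewrite /= subnKC.
Qed.

Lemma mul_upE p (Y : 'M[int]_(n, p)) : up *m Y = rowsub up_ord Y.
Proof. by rewrite /up mul_rowsub_mx mul1mx. Qed.

Lemma mul_lowE p (Y : 'M[int]_(n, p)) : low *m Y = rowsub low_ord Y.
Proof. by rewrite /low mul_rowsub_mx mul1mx. Qed.

Lemma mul_trE p q (f : 'I_q -> 'I_n) (Y : 'M[int]_(p, n)) :
  Y *m (rowsub f 1%:M)^T = colsub f Y.
Proof. by rewrite trmx_mxsub trmx1 mulmx_colsub mulmx1. Qed.

Lemma up_upT : up *m up^T = 1%:M.
Proof.
by rewrite mul_trE; apply/matrixP => i j; rewrite !mxE (inj_eq up_ord_inj).
Qed.

Lemma low_lowT : low *m low^T = 1%:M.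
Proof.
by rewrite mul_trE; apply/matrixP => i j; rewrite !mxE (inj_eq low_ord_inj).
Qed.

Lemma up_lowT : up *m low^T = 0.
Proof. by rewrite mul_trE; apply/matrixP => i j; rewrite !mxE up_low_neq. Qed.

Lemma low_upT : low *m up^T = 0.
Proof. by rewrite mul_trE; apply/matrixP => i j; rewrite !mxE eq_sym up_low_neq. Qed.

Lemma up_low_partition : up^T *m up + low^T *m low = 1%:M.
Proof.
set X := _ + _.
have XU : X *m up^T = up^T.
  by rewrite mulmxDl -!mulmxA up_upT low_upT mulmx1 mulmx0 addr0.
have XL : X *m low^T = low^T.
  by rewrite mulmxDl -!mulmxA up_lowT low_lowT mulmx1 mulmx0 add0r.
apply/matrixP => b a; have [[i ->]|[j ->]] := up_low_ord a.
  have := congr1 (fun M : 'M[int]_(n, n - r) => M b i) XU.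
  by rewrite mul_trE !mxE eq_sym.
have := congr1 (fun M : 'M[int]_(n, r) => M b j) XL.
by rewrite mul_trE !mxE eq_sym.
Qed.

Lemma parabolicP (Q : 'M[int]_n) :
  parabolic n r Q <-> Q \in unitmx /\ low *m Q *m up^T = 0.
Proof.
have E i j : (low *m Q *m up^T) j i = Q (low_ord j) (up_ord i).
  by rewrite mul_trE mul_lowE !mxE.
split=> -[Qu Q0]; split=> //.
  by apply/matrixP => j i; rewrite E mxE Q0//= leq_addr andbT.
move=> i j /andP[jn ni].
have [[j' jE]|[i' iE]] := up_low_ord j; last by move: jn; rewrite iE /= ltnNge leq_addr.
have [[i' iE]|[i' iE]] := up_low_ord i.
  by move: ni; rewrite iE leqNgt /= ltn_ord.
by rewrite iE jE -E Q0 mxE.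
Qed.

Lemma ulblockE (Q : 'M[int]_n) : ulblock r Q = up *m Q *m up^T.
Proof. by rewrite mul_trE mul_upE; apply/matrixP => i j; rewrite !mxE. Qed.

Lemma std_summandP (v : 'cV[int]_n) : std_summand n r v <-> low *m v = 0.
Proof.
rewrite mul_lowE; split=> [v0|/colP v0 i ni].
  by apply/colP => j; rewrite !mxE v0//= leq_addr.
have [[i' iE]|[j iE]] := up_low_ord i.
  by move: ni; rewrite iE leqNgt /= ltn_ord.
by have := v0 j; rewrite !mxE -iE.
Qed.

Lemma std_summand_up (v : 'cV[int]_n) : std_summand n r v -> v = up^T *m (up *m v).
Proof.
move=> /std_summandP v0.
by rewrite -[LHS]mul1mx -up_low_partition mulmxDl -!mulmxA v0 mulmx0 addr0.
Qed.

Lemma low_split (p : nat) (Y : 'M[int]_(n, p)) :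
  Y = up^T *m (up *m Y) + low^T *m (low *m Y).
Proof. by rewrite !mulmxA -mulmxDl up_low_partition mul1mx. Qed.

Lemma parabolic_low (Q : 'M[int]_n) : parabolic n r Q ->
  low *m Q = low *m Q *m low^T *m low.
Proof.
move=> /parabolicP[_ Q0].
rewrite -[LHS]mulmx1 -up_low_partition mulmxDr !mulmxA Q0 mul0mx add0r.
by [].
Qed.

(** The lower right block of [Q] has a right inverse, hence an inverse. *)
Lemma lrblock_inv (Q : 'M[int]_n) : parabolic n r Q ->
  (low *m invmx Q *m low^T) *m (low *m Q *m low^T) = 1%:M.
Proof.
move=> PQ; have [Qu _] := (iffLR (parabolicP Q)) PQ.
apply: mulmx1C; rewrite !mulmxA -(parabolic_low PQ) -[low *m Q *m _]mulmxA.
by rewrite mulmxV// mulmx1 low_lowT.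
Qed.

Lemma parabolic_inv (Q : 'M[int]_n) : parabolic n r Q -> parabolic n r (invmx Q).
Proof.
move=> PQ; have [Qu _] := (iffLR (parabolicP Q)) PQ.
apply/parabolicP; split; first by rewrite unitmx_inv.
have SQ := lrblock_inv PQ; set S := _ *m low^T in SQ.
rewrite -[low *m invmx Q]mul1mx -SQ.
rewrite -[S *m _ *m _]mulmxA (mulmxA (low *m Q *m low^T)) -(parabolic_low PQ).
by rewrite -(mulmxA low) mulmxV// mulmx1 -mulmxA low_upT mulmx0.
Qed.

(** As [invmx Q] is parabolic too, its upper left block is the inverse. *)
Lemma ulblock_unit (Q : 'M[int]_n) : parabolic n r Q -> ulblock r Q \in unitmx.
Proof.
move=> PQ; have [Qu _] := (iffLR (parabolicP Q)) PQ.
have [_ Q0] := (iffLR (parabolicP _)) (parabolic_inv PQ).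
have : ulblock r Q *m ulblock r (invmx Q) = 1%:M.
  rewrite !ulblockE.
  transitivity (up *m Q *m (up^T *m up + low^T *m low) *m invmx Q *m up^T).
    by rewrite mulmxDr mulmxDl mulmxDl !mulmxA -[_ *m low *m invmx Q *m _]mulmxA
      -[_ *m low *m _]mulmxA (mulmxA low) Q0 mulmx0 addr0.
  by rewrite up_low_partition mulmx1 -[up *m Q *m _]mulmxA mulmxV// mulmx1 up_upT.
by move=> /mulmx1_unit[].
Qed.

Lemma parabolic1 : parabolic n r 1%:M.
Proof. by apply/parabolicP; rewrite unitmx1 mulmx1 low_upT. Qed.

Lemma parabolic_std (Q : 'M[int]_n) v : parabolic n r Q -> std_summand n r v ->
  std_summand n r (Q *m v).
Proof.
move=> /parabolic_low QE /std_summandP v0; apply/std_summandP.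
by rewrite mulmxA QE -mulmxA v0 mulmx0.
Qed.

Lemma parabolic_mul (Q Q' : 'M[int]_n) : parabolic n r Q -> parabolic n r Q' ->
  parabolic n r (Q *m Q').
Proof.
move=> PQ /parabolicP[Q'u Q'0]; have [Qu _] := (iffLR (parabolicP Q)) PQ.
apply/parabolicP; split; first by rewrite unitmx_mul Qu.
by rewrite mulmxA (parabolic_low PQ) -[_ *m Q']mulmxA -[_ *m up^T]mulmxA Q'0 mulmx0.
Qed.

(** A basis [B] of a direct summand, a basis [B'] of a complement and the dual
    bases [C] and [C'] make up an invertible matrix. *)
Lemma complementary_dim k l (B : 'M[int]_(n, k)) (B' : 'M[int]_(n, l)) C C' :
  B *m C + B' *m C' = 1%:M -> C *m B = 1%:M -> C' *m B' = 1%:M ->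
  C *m B' = 0 -> C' *m B = 0 -> (k + l = n)%N.
Proof.
move=> BC CB C'B' CB' C'B; apply/eqP; rewrite eqn_leq.
have h1 : row_mx B B' *m col_mx C C' = 1%:M by rewrite mul_row_col.
have h2 : col_mx C C' *m row_mx B B' = 1%:M.
  by rewrite mul_col_row CB C'B' CB' C'B -scalar_mx_block.
by rewrite (mulmx1_min h1) (mulmx1_min h2).
Qed.

Lemma completion (B : 'M[int]_(n, n - r)) (B' : 'M[int]_(n, r)) C C' :
  B *m C + B' *m C' = 1%:M -> C' *m B' = 1%:M -> C' *m B = 0 ->
  exists M, [/\ M \in unitmx, M *m up^T = B & C' *m M = low].
Proof.
move=> BC C'B' C'B; exists (B *m up + B' *m low).
have : (B *m up + B' *m low) *m (up^T *m C + low^T *m C') = 1%:M.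
  rewrite mulmxDl !mulmxDr -!mulmxA !(mulmxA up) !(mulmxA low).
  by rewrite up_upT up_lowT low_upT low_lowT !mul0mx !mul1mx !mulmx0 addr0 add0r.
move=> /mulmx1_unit[Mu _]; split=> //.
  by rewrite mulmxDl -!mulmxA up_upT low_upT mulmx0 mulmx1 addr0.
by rewrite mulmxDr !mulmxA C'B' C'B mul0mx add0r mul1mx.
Qed.

End Blocks.

Lemma mulmx_inj0 n k p (B : 'M[int]_(n, k)) (Y : 'M[int]_(k, p)) :
  (forall c : 'cV_k, B *m c = 0 -> c = 0) -> B *m Y = 0 -> Y = 0.
Proof.
move=> Binj BY; apply/matrixP => i j.
have /colP/(_ i) : col j Y = 0 by apply: Binj; rewrite colE mulmxA BY mul0mx.
by rewrite !mxE.
Qed.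

Lemma mulmx_cV_eq n p (Y Z : 'M[int]_(n, p)) :
  (forall c : 'cV_p, Y *m c = Z *m c) -> Y = Z.
Proof.
move=> YZ; apply/matrixP => i j.
by have /colP/(_ i) := YZ (delta_mx j 0); rewrite -!colE !mxE.
Qed.

(** A surjection to [Z^r] becomes the projection to the last coordinates after a
    change of basis of the source: complete a section by a basis of the kernel. *)
Lemma surjection_normal_form n r (N : 'M[int]_(r, n)) S : N *m S = 1%:M ->
  exists rn : (r <= n)%N, exists2 M, M \in unitmx & N *m M = low rn.
Proof.
move=> NS; have rn := mulmx1_min NS; exists rn.
have Ksub : is_subgroup [set x : 'cV[int]_n | N *m x = 0].
  by split=> [|x y /= x0 y0]; rewrite /= ?mulmx0// mulmxBr x0 y0 subrr.
have [k [B [BK Binj]]] := subgroup_basis Ksub.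
have NB : N *m B = 0.
  apply: mulmx_cV_eq => c; rewrite mul0mx -mulmxA; apply/BK; by exists c.
have /choice[C0 C0E] (j : 'I_n) : exists c, col j (1%:M - S *m N) = B *m c.
  by apply/BK; rewrite /= colE mulmxA mulmxBr mulmx1 mulmxA NS mul1mx subrr mul0mx.
pose C : 'M[int]_(k, n) := \matrix_(i, j) C0 j i 0.
have BC : B *m C = 1%:M - S *m N.
  apply/matrixP => i j; have /colP/(_ i) := C0E j; rewrite [LHS]mxE => ->.
  by rewrite !mxE; apply: eq_bigr => l _; rewrite mxE.
have BCSN : B *m C + S *m N = 1%:M by rewrite BC subrK.
have CS : C *m S = 0.
  by apply: (mulmx_inj0 Binj); rewrite mulmxA BC mulmxBl mul1mx -mulmxA NS mulmx1 subrr.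
have CB : C *m B = 1%:M.
  apply/eqP; rewrite -subr_eq0; apply/eqP/(mulmx_inj0 Binj).
  by rewrite mulmxBr mulmxA BC mulmxBl mul1mx -mulmxA NB mulmx0 subr0 mulmx1 subrr.
have kr := complementary_dim BCSN CB NS CS NB.
have {kr} : k = (n - r)%N by rewrite -kr addnK.
move=> kE; subst k.
by have [M [Mu _ NM]] := completion rn BCSN NS NB; exists M.
Qed.

Section Grassmannian.
Variables (n r : nat) (rn : (r <= n)%N).
Local Notation up := (up n r).
Local Notation low := (low rn).

Definition coset_summand (Y : set 'M[int]_n) : set 'cV[int]_n :=
  [set x | exists M v, [/\ Y M, std_summand n r v & x = M *m v]].

Lemma coset_summandE M :
  coset_summand [set M *m Q | Q in parabolic n r] = [set M *m v | v in std_summand n r].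
Proof.
apply/seteqP; split=> [_ [_ [v [[Q PQ <-] Sv ->]]]|_ [v Sv <-]].
  by exists (Q *m v); [exact: (parabolic_std rn)|rewrite mulmxA].
exists M, v; split=> //; exists 1%:M; last exact: mulmx1.
exact: (parabolic1 rn).
Qed.

Lemma image_std_Gr M : GLZ n M -> Gr (n - r)%N n [set M *m v | v in std_summand n r].
Proof.
move=> Mu; have lowS v : std_summand n r v <-> low *m v = 0 := std_summandP rn v.
have sub : is_subgroup [set M *m v | v in std_summand n r].
  split; first by exists 0; rewrite ?mulmx0//; apply/lowS; rewrite mulmx0.
  move=> _ _ [v /lowS v0 <-] [w /lowS w0 <-]; exists (v - w); last by rewrite mulmxBr.
  by apply/lowS; rewrite mulmxBr v0 w0 subrr.
split.
  split=> //; exists [set M *m v | v in [set v | up *m v = 0]]; split.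
  - split; first by exists 0; rewrite ?mulmx0//= mulmx0.
    move=> _ _ [v /= v0 <-] [w /= w0 <-]; exists (v - w); last by rewrite mulmxBr.
    by rewrite /= mulmxBr v0 w0 subrr.
  - apply/seteqP; split=> [x [[v /lowS v0 <-] [w /= w0 /(can_inj (mulKmx Mu)) wv]]|_ ->].
      by rewrite (low_split rn v) v0 -wv w0 !mulmx0 addr0 mulmx0.
    by split; exists 0; rewrite ?mulmx0//=; [apply/lowS|]; rewrite mulmx0.
  - move=> x; pose y := invmx M *m x.
    exists (M *m (up^T *m (up *m y))), (M *m (low^T *m (low *m y))); split.
    + by exists (up^T *m (up *m y)) => //; apply/lowS; rewrite mulmxA low_upT mul0mx.
    + by exists (low^T *m (low *m y)) => //=; rewrite mulmxA up_lowT mul0mx.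
    + by rewrite -mulmxDr -low_split mulKVmx.
apply: (has_rankP (p := mulmx (up *m invmx M)) (s := mulmx (M *m up^T))) => //=.
- move=> c; exists (up^T *m c); last by rewrite mulmxA.
  by apply/lowS; rewrite mulmxA low_upT mul0mx.
- by move=> c /=; rewrite -!mulmxA mulKmx// mulmxA up_upT mul1mx.
move=> _ [v Sv <-]; rewrite -mulmxA mulKmx// => v0.
by rewrite (std_summand_up rn Sv) v0 !mulmx0 rpred0.
Qed.

Lemma std_image_parabolic M M' : GLZ n M -> GLZ n M' ->
  [set M' *m v | v in std_summand n r] `<=` [set M *m v | v in std_summand n r] ->
  parabolic n r (invmx M *m M').
Proof.
move=> Mu M'u MM'; apply/(parabolicP rn); split.
  by rewrite unitmx_mul unitmx_inv Mu.
apply: mulmx_cV_eq => c; rewrite mul0mx -!mulmxA.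
have [|v Sv vE] := MM' (M' *m (up^T *m c)).
  by exists (up^T *m c) => //; apply/(std_summandP rn); rewrite mulmxA low_upT mul0mx.
by rewrite -vE mulKmx//; apply/(std_summandP rn).
Qed.

(** The columns of [M] are a basis of [S] followed by one of a complement. *)
Lemma Gr_image_std S : Gr (n - r)%N n S ->
  exists2 M, GLZ n M & [set M *m v | v in std_summand n r] = S.
Proof.
move=> [[Ssub [T [Tsub ST0 SpT]]] rkS].
have [k [B [BS Binj]]] := subgroup_basis Ssub.
have [l [B' [BT B'inj]]] := subgroup_basis Tsub.
have /choice[cc ccE] (j : 'I_n) : exists cd : 'cV[int]_k * 'cV[int]_l,
    delta_mx j 0 = B *m cd.1 + B' *m cd.2.
  have [_ [_ [/BS[c ->] /BT[d ->] ->]]] := SpT (delta_mx j 0).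
  by exists (c, d).
pose C : 'M[int]_(k, n) := \matrix_(i, j) (cc j).1 i 0.
pose C' : 'M[int]_(l, n) := \matrix_(i, j) (cc j).2 i 0.
have BC : B *m C + B' *m C' = 1%:M.
  apply/matrixP => i j; have /colP/(_ i) := ccE j; rewrite [LHS]mxE andbT => E.
  rewrite [RHS]mxE E !mxE; congr (_ + _); apply: eq_bigr => a _; by rewrite mxE.
have cancel0 p (Y : 'M[int]_(k, p)) (Z : 'M[int]_(l, p)) : B *m Y = B' *m Z -> Y = 0 /\ Z = 0.
  move=> YZ; have Y0 : B *m Y = 0.
    apply: mulmx_cV_eq => c; rewrite mul0mx.
    have : (S `&` T) (B *m Y *m c).
      split; first by apply/BS; exists (Y *m c); rewrite mulmxA.
      by apply/BT; exists (Z *m c); rewrite YZ mulmxA.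
    by rewrite ST0.
  split; first exact: (mulmx_inj0 Binj).
  by apply: (mulmx_inj0 B'inj); rewrite -YZ.
have [CB C'B] : C *m B = 1%:M /\ C' *m B = 0.
  have [|E1 E2] := cancel0 k (1%:M - C *m B) (C' *m B).
    rewrite mulmxBr mulmx1 !mulmxA -{1}[B]mul1mx -BC mulmxDl.
    by rewrite addrC addKr.
  by split=> //; apply/eqP; rewrite eq_sym -subr_eq0 E1.
have [CB' C'B'] : C *m B' = 0 /\ C' *m B' = 1%:M.
  have [|E1 E2] := cancel0 l (C *m B') (1%:M - C' *m B').
    rewrite mulmxBr mulmx1 !mulmxA -{2}[B']mul1mx -BC mulmxDl.
    by rewrite addrK.
  by split=> //; apply/eqP; rewrite eq_sym -subr_eq0 E2.
have kl := complementary_dim BC CB C'B' CB' C'B.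
have kE : k = (n - r)%N.
  apply: (@has_rank_unique _ S) => //.
  apply: (has_rankP (p := mulmx C) (s := mulmx B)) => //=.
  - by move=> c; apply/BS; exists c.
  - by move=> c /=; rewrite mulmxA CB mul1mx.
  by move=> x /BS[c ->]; rewrite mulmxA CB mul1mx => ->; rewrite mulmx0 rpred0.
subst k; have lE : l = r by apply/eqP; rewrite -(eqn_add2l (n - r)) kl subnK.
subst l; have [M [Mu MB _]] := completion rn BC C'B' C'B.
exists M => //; apply/seteqP; split=> [_ [v Sv <-]|x /BS[c ->]].
  rewrite (std_summand_up rn Sv) mulmxA MB; apply/BS; by eexists.
exists (up^T *m c); last by rewrite mulmxA MB.
by apply/(std_summandP rn); rewrite mulmxA low_upT mul0mx.
Qed.

Theorem coset_summand_bij : set_bij (GL_mod_parabolic n r) (Gr (n - r)%N n) coset_summand.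
Proof.
split.
- move=> _ [M Mu <-]; rewrite coset_summandE; exact: image_std_Gr.
- move=> X Y /set_mem[M Mu <-] /set_mem[M' M'u <-]; rewrite !coset_summandE => E.
  suff H N N' : GLZ n N -> GLZ n N' ->
      [set N' *m v | v in std_summand n r] `<=` [set N *m v | v in std_summand n r] ->
      [set N' *m Q | Q in parabolic n r] `<=` [set N *m Q | Q in parabolic n r].
    by apply/seteqP; split; apply: H => //; rewrite E.
  move=> Nu N'u NN' _ [Q PQ <-]; exists (invmx N *m N' *m Q).
    by apply: (parabolic_mul rn) => //; exact: std_image_parabolic.
  by rewrite !mulmxA mulmxV// mul1mx.
- move=> S /Gr_image_std[M Mu ME].
  by exists [set M *m Q | Q in parabolic n r]; [exists M|rewrite coset_summandE].
Qed.

End Grassmannian.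

(** * Realizing epimorphisms *)

Lemma additive_bij (K B : zmodType) (f : {additive K -> B}) :
  (forall x, f x = 0 -> x = 0) -> epi f -> bijective f.
Proof.
move=> f0 /choice[g gK]; exists g => // x.
by apply/eqP; rewrite -subr_eq0; apply/eqP/f0; rewrite raddfB gK subrr.
Qed.

Lemma additive_inv (K B : zmodType) (f : {additive K -> B}) : bijective f ->
  exists g : {additive B -> K}, cancel f g /\ cancel g f.
Proof.
move=> [g fK gK].
have gB : {morph g : x y / x - y}.
  by move=> x y; apply: (can_inj fK); rewrite raddfB !gK.
by exists (additive_of gB).
Qed.

Lemma additive_mx n m (f : {additive 'cV[int]_n -> 'cV[int]_m}) :
  exists N : 'M[int]_(m, n), forall v, f v = N *m v.
Proof.
exists (\matrix_(i, j) f (delta_mx j 0) i 0) => v.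
rewrite additive_lincomb; apply/colP => i; rewrite /lincomb summxE mxE.
by apply: eq_bigr => j _; rewrite -scaler_int intz !mxE mulrC.
Qed.

Lemma torsion_additive (K B : zmodType) (f : {additive K -> B}) x :
  x \in torsion K -> f x \in torsion B.
Proof.
by move=> /torsionP[N N0 xN]; apply/torsionP; exists N => //; rewrite -raddfMn xN raddf0.
Qed.

Section Equivalence.
Variables K B : zmodType.

Definition equiv_epi (f g : {additive K -> B}) : Prop :=
  exists2 a : {additive B -> B}, bijective a & g =1 a \o f.

Lemma equiv_epi_refl f : equiv_epi f f.
Proof. by exists idfun; first by exists idfun. Qed.

Lemma equiv_epi_sym f g : equiv_epi f g -> equiv_epi g f.
Proof.
move=> [a abij gaf]; have [b [aK bK]] := additive_inv abij.
by exists b; [exists a|move=> x; rewrite /= gaf /= aK].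
Qed.

Lemma equiv_epi_trans g f h : equiv_epi f g -> equiv_epi g h -> equiv_epi f h.
Proof.
move=> [a abij gaf] [b bbij hbg]; exists (b \o a : {additive B -> B}).
  exact: bij_comp.
by move=> x; rewrite /= hbg /= gaf.
Qed.

Lemma equiv_epi_epi f g : equiv_epi f g -> epi f -> epi g.
Proof.
move=> [a [b aK bK] gaf] fe y; have [x xE] := fe (b y).
by exists x; rewrite gaf /= xE bK.
Qed.

Definition epi_class (f : {additive K -> B}) : set {additive K -> B} :=
  [set g | Epi K B g /\ equiv_epi f g].

Lemma epi_class_eq f g : equiv_epi f g -> epi_class f = epi_class g.
Proof.
move=> fg; apply/seteqP; split=> h [he fh]; split=> //.
  exact: equiv_epi_trans (equiv_epi_sym fg) fh.
exact: equiv_epi_trans fg fh.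
Qed.

End Equivalence.

Section Realization.
Variables (H A : zmodType) (n r : nat) (D : splitting H A n r).
Variable (rn : (r <= n)%N).
Local Notation up := (up n r).
Local Notation low := (low rn).
Local Notation pH := (projH D).
Local Notation sH := (secH D).
Local Notation pA := (projA D).
Local Notation sA := (secA D).
Local Notation qA := (quotmap (im_pred (secA D))).

Lemma torsH_subproof x : x - sH (pH x) \in torsion H.
Proof. by apply/(projH_ker D); rewrite raddfB /= secHK subrr. Qed.

Definition torsH_fun (x : H) : Tors H := exist _ (x - sH (pH x)) (torsH_subproof x).

Lemma torsH_funB : {morph torsH_fun : x y / x - y}.
Proof.
move=> x y; apply: val_inj => /=.
rewrite [pH _]raddfB [sH _]raddfB opprD addrACA -opprD.
by [].
Qed.

Definition torsH : {additive H -> Tors H} := additive_of torsH_funB.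

Lemma torsH_split x : x = sH (pH x) + val (torsH x).
Proof. by rewrite /= addrC subrK. Qed.

Lemma pH_sum v (t : Tors H) : pH (sH v + val t) = v.
Proof. by rewrite raddfD /= secHK (iffRL (projH_ker D _) (valP t)) addr0. Qed.

Lemma torsH_sum v (t : Tors H) : torsH (sH v + val t) = t.
Proof. by apply: val_inj; rewrite /= pH_sum addrC addKr. Qed.

Lemma qA_sA v : qA (sA v) = 0.
Proof. by apply/quotmap_eq0; rewrite unfold_in; apply/asboolP; exists v. Qed.

(** The quotient of [A] by the copy of [Z^r] embeds in [A], onto the torsion
    subgroup. *)
Lemma torsA_exists : exists f : {additive AmodA D -> A},
  forall a, f (qA a) = a - sA (pA a).
Proof.
have /choice[f fE] b : exists z, forall a, qA a = b -> z = a - sA (pA a).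
  have [a0 <-] := quotmap_epi b; exists (a0 - sA (pA a0)) => a E.
  have : qA (a0 - a) = 0 by rewrite raddfB E subrr.
  move=> /quotmap_eq0; rewrite unfold_in => /asboolP[u uE].
  have aE : a0 = a + sA u by rewrite uE addrC subrK.
  by rewrite aE (raddfD pA) /= secAK (raddfD sA) opprD addrACA subrr addr0.
have fB : {morph f : x y / x - y}.
  move=> x y; have [a ax] := quotmap_epi x; have [b bx] := quotmap_epi y.
  rewrite (fE _ _ ax) (fE _ _ bx) (fE (x - y) (a - b)); last by rewrite raddfB ax bx.
  rewrite [pA _]raddfB [sA _]raddfB opprD addrACA -opprD.
  by [].
by exists (additive_of fB) => a; exact: fE.
Qed.

Definition tA : {additive AmodA D -> A} := projT1 (cid torsA_exists).

Lemma tAE a : tA (qA a) = a - sA (pA a).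
Proof. exact: (projT2 (cid torsA_exists)). Qed.

Lemma pA_tA b : pA (tA b) = 0.
Proof.
have [a <-] := quotmap_epi b.
by rewrite tAE raddfB /= secAK subrr.
Qed.

Lemma qA_tA b : qA (tA b) = b.
Proof. by have [a <-] := quotmap_epi b; rewrite tAE raddfB /= qA_sA subr0. Qed.

Lemma tA_torsion b : tA b \in torsion A.
Proof. by apply/(projA_ker D); exact: pA_tA. Qed.

Lemma A_split a : a = sA (pA a) + tA (qA a).
Proof. by rewrite tAE addrC subrK. Qed.

Lemma A_eq a b : pA a = pA b -> qA a = qA b -> a = b.
Proof. by move=> pE qE; rewrite (A_split a) pE qE -A_split. Qed.

Lemma pA_sum v b : pA (sA v + tA b) = v.
Proof. by rewrite raddfD /= secAK pA_tA addr0. Qed.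

Lemma qA_sum v b : qA (sA v + tA b) = b.
Proof. by rewrite raddfD /= qA_sA qA_tA add0r. Qed.

Lemma torsion_tA a : a \in torsion A -> a = tA (qA a).
Proof. by move=> /(projA_ker D) pa; rewrite [LHS]A_split pa raddf0 add0r. Qed.

Section Realize.
Variables (M : 'M[int]_n) (g : {additive HmodA D -> AmodA D}).

Definition base (x : H) : 'cV[int]_n := invmx M *m pH x.

Definition realize_fun (x : H) : A :=
  sA (low *m base x) + tA (g (quoH D (up *m base x, torsH x))).

Lemma realize_funB : {morph realize_fun : x y / x - y}.
Proof.
move=> x y.
have bB : base (x - y) = base x - base y by rewrite /base raddfB mulmxBr.
have tB : torsH (x - y) = torsH x - torsH y by exact: raddfB.
apply: A_eq.
  by rewrite [RHS]raddfB !pA_sum bB mulmxBr.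
rewrite [RHS]raddfB !qA_sum bB tB mulmxBr.
rewrite (_ : (up *m base x - up *m base y, torsH x - torsH y) =
  (up *m base x, torsH x) - (up *m base y, torsH y) :> ('cV[int]_(n - r) * Tors H)%type)//.
by rewrite raddfB [LHS]raddfB.
Qed.

(** The epimorphism given by a basis of [Z^n], whose first [n - r] members span
    the free part of the kernel of the projection to [Z^r], and by its effect
    on these members and on torsion. *)
Definition realize : {additive H -> A} := additive_of realize_funB.

Lemma pA_realize x : pA (realize x) = low *m base x.
Proof. exact: pA_sum. Qed.

Lemma qA_realize x : qA (realize x) = g (quoH D (up *m base x, torsH x)).
Proof. exact: qA_sum. Qed.

End Realize.

Lemma base_sum M v (t : Tors H) : M \in unitmx -> base M (sH (M *m v) + val t) = v.
Proof. by move=> Mu; rewrite /base pH_sum mulKmx. Qed.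

Lemma quoH_epi b : exists v t, quoH D (v, t) = b.
Proof. by have [k _ kK] := quoH_bij D; exists (k b).1, (k b).2; rewrite -surjective_pairing kK. Qed.

Lemma realize_epi M g : M \in unitmx -> epi g -> epi (realize M g).
Proof.
move=> Mu ge a; have [b gb] := ge (qA a); have [v [t vt]] := quoH_epi b.
exists (sH (M *m (up^T *m v + low^T *m pA a)) + val t).
apply: A_eq.
  rewrite pA_realize base_sum// mulmxDr !mulmxA low_upT low_lowT mul0mx mul1mx.
  by rewrite add0r.
rewrite qA_realize base_sum// torsH_sum mulmxDr !mulmxA up_upT up_lowT mul0mx mul1mx.
by rewrite addr0 vt.
Qed.

Lemma act_base M Q x : M \in unitmx -> Q \in unitmx -> base M x = Q *m base (M *m Q) x.
Proof.
move=> Mu Qu; rewrite /base.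
have -> : invmx (M *m Q) = invmx Q *m invmx M.
  have MQu : M *m Q \in unitmx by rewrite unitmx_mul Mu.
  apply: (can_inj (mulKmx MQu)); rewrite mulmxV// mulmxA -(mulmxA M) mulmxV//.
  by rewrite mulmx1 mulmxV.
by rewrite -mulmxA mulKVmx.
Qed.

(** A change of basis in the parabolic subgroup moves [realize] by an automorphism
    of [A]: its lower right block acts on [Z^r] and its upper right block
    accounts for the choice of a complement. *)
Lemma realize_act M Q g g' : M \in unitmx -> parabolic n r Q -> epi g ->
  act Q (epi_class g) g' -> equiv_epi (realize (M *m Q) g) (realize M g').
Proof.
move=> Mu PQ ge [g1 [g1e [a abij g1a]] g'E].
have [Qu Q0] := (iffLR (parabolicP rn Q)) PQ.
pose Q3 := low *m Q *m low^T.
(* [c] is the contribution of the upper right block to the torsion component. *)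
pose c (z : A) := a (g (quoH D (invmx (ulblock r Q) *m (up *m Q *m low^T *m pA z), 0))).
have cB : {morph c : z z' / z - z'}.
  move=> z z'; rewrite /c raddfB /= !mulmxBr.
  rewrite (_ : (_ - _, 0) = (invmx (ulblock r Q) *m (up *m Q *m low^T *m pA z), 0)
    - (invmx (ulblock r Q) *m (up *m Q *m low^T *m pA z'), 0)
    :> ('cV[int]_(n - r) * Tors H)%type); last by congr pair; rewrite subrr.
  by rewrite [quoH _ _]raddfB [g _]raddfB [LHS]raddfB.
pose al z := sA (Q3 *m pA z) + tA (a (qA z) + c z).
have alB : {morph al : z z' / z - z'}.
  move=> z z'; apply: A_eq.
    by rewrite [RHS]raddfB !pA_sum raddfB mulmxBr.
  rewrite [RHS]raddfB !qA_sum cB [qA _]raddfB [a _]raddfB /=.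
  by rewrite opprD addrACA.
exists (additive_of alB).
  have Q3K := lrblock_inv rn PQ; have Q3K' := mulmx1C Q3K.
  apply: additive_bij => [z alz|z].
    have pz : pA z = 0.
      have : pA (al z) = 0 by rewrite [al z]alz raddf0.
      rewrite pA_sum => E; rewrite -[pA z]mul1mx -Q3K -mulmxA.
      by rewrite -/Q3 E mulmx0.
    have cz : c z = 0 by rewrite /c pz !mulmx0 (_ : quoH D _ = 0) ?raddf0//; exact: raddf0.
    have : qA (al z) = 0 by rewrite [al z]alz raddf0.
    rewrite qA_sum cz addr0 => az.
    apply: A_eq; first by rewrite pz raddf0.
    by rewrite raddf0; apply: (bij_inj abij); rewrite az raddf0.
  have [b aK bK] := abij.
  pose w := low *m invmx Q *m low^T *m pA z.
  pose cw := c (sA w).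
  exists (sA w + tA (b (qA z - cw))).
  apply: A_eq; first by rewrite pA_sum pA_sum mulmxA Q3K' mul1mx.
  rewrite qA_sum qA_sum bK.
  by rewrite (_ : c _ = cw) ?subrK// /cw /c pA_sum secAK.
move=> x; pose y := base (M *m Q) x.
have yE : base M x = Q *m y := act_base _ Mu Qu.
apply: A_eq.
  rewrite pA_realize yE [RHS]pA_sum pA_realize -/y.
  by rewrite mulmxA (parabolic_low rn PQ) -!mulmxA.
rewrite qA_realize yE g'E g1a [RHS]qA_sum qA_realize /c pA_realize -/y /=.
rewrite -!raddfD; congr (a (g (quoH D _))).
rewrite [RHS](_ : _ = (up *m y + invmx (ulblock r Q) *m (up *m Q *m low^T *m (low *m y)),
  torsH x + 0))//; congr pair; last by rewrite addr0.
apply: (can_inj (mulKmx (ulblock_unit rn PQ))).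
rewrite mulKVmx ?(ulblock_unit rn PQ)// mulmxDr.
rewrite mulKVmx ?(ulblock_unit rn PQ)// ulblockE.
by rewrite [in LHS](low_split rn y) !mulmxDr !mulmxA.
Qed.

(** An automorphism of [A] preserves torsion. The map it induces on [Z^r] makes the
    change of basis parabolic; its restriction to torsion, seen as an automorphism of
    the quotient of [A] by the copy of [Z^r], relates [g] and [g']. *)
Lemma act_realize M M' g g' : M \in unitmx -> M' \in unitmx ->
  epi g -> epi g' -> equiv_epi (realize M g) (realize M' g') ->
  exists2 Q, parabolic n r Q & M = M' *m Q /\ epi_class g' = act Q (epi_class g).
Proof.
move=> Mu M'u ge g'e [al albij alE0].
have alE x : realize M' g' x = al (realize M g x) := alE0 x.
pose Q := invmx M' *m M.
have MQ : M = M' *m Q by rewrite mulKVmx.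
have baseE x : base M' x = Q *m base M x.
  by rewrite /base /Q -!mulmxA mulKVmx.
have Qu : Q \in unitmx by rewrite unitmx_mul unitmx_inv M'u.
clearbody Q; have torsal a : a \in torsion A -> al a \in torsion A by exact: torsion_additive.
have real0 v t : realize M g (sH (M *m (up^T *m v)) + val t) = tA (g (quoH D (v, t))).
  apply: A_eq; first by rewrite pA_realize base_sum// mulmxA low_upT mul0mx pA_tA.
  by rewrite qA_realize base_sum// torsH_sum mulmxA up_upT mul1mx qA_tA.
have PQ : parabolic n r Q.
  apply/(parabolicP rn); split=> //; apply: mulmx_cV_eq => v; rewrite mul0mx -!mulmxA.
  pose x := sH (M *m (up^T *m v)) + val (0 : Tors H).
  have := congr1 pA (alE x); rewrite real0 pA_realize baseE base_sum// => ->.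
  by apply/(projA_ker D)/torsal; exact: tA_torsion.
exists Q => //; split=> //.
have aB : {morph (fun b => qA (al (tA b))) : b b' / b - b'}.
  by move=> b b'; rewrite (raddfB tA) (raddfB al) raddfB.
pose a := additive_of aB.
have abij : bijective a.
  apply: additive_bij => [b ab|b].
    have : al (tA b) = 0.
      by rewrite (torsion_tA (torsal _ (tA_torsion b))) [qA _]ab raddf0.
    rewrite -(raddf0 al) => /(bij_inj albij) tb.
    by rewrite -(qA_tA b) tb raddf0.
  have [be [alK beK]] := additive_inv albij.
  exists (qA (be (tA b))); rewrite /a /=.
  rewrite -torsion_tA; first by rewrite beK qA_tA.
  by apply: torsion_additive; exact: tA_torsion.
(* Elements of [H] with zero last coordinates are mapped to torsion, where [al] acts
   through [a]. *)
have key v t : g' (quoH D (v, t)) = a (g (quoH D (invmx (ulblock r Q) *m v, t))).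
  pose w := invmx (ulblock r Q) *m v.
  rewrite [RHS]/= -real0 -alE qA_realize baseE base_sum// torsH_sum.
  rewrite !mulmxA -ulblockE -mulmxA mulKVmx//.
  exact: (ulblock_unit rn PQ).
apply/seteqP; split=> h.
  move=> [he [b bbij hb]]; exists (b \o a \o g : {additive HmodA D -> AmodA D}).
    split; last by exists (b \o a : {additive AmodA D -> AmodA D}) => //; exact: bij_comp.
    apply: (equiv_epi_epi (f := g)) => //.
    by exists (b \o a : {additive AmodA D -> AmodA D}) => //; exact: bij_comp.
  by move=> v t; rewrite hb /= key.
move=> [g1 [g1e [b bbij g1b]] hE].
suff gh : equiv_epi g' h by split=> //; exact: equiv_epi_epi gh g'e.
have [ai [aiK aKi]] := additive_inv abij.
exists (b \o ai : {additive AmodA D -> AmodA D}).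
  by apply: bij_comp => //; exists a.
move=> k; have [v [t <-]] := quoH_epi k.
by rewrite hE g1b /= key aiK.
Qed.

Lemma act1 (g : {additive HmodA D -> AmodA D}) c : c g -> act 1%:M c g.
Proof.
move=> cg; exists g => // v t.
by rewrite ulblockE mulmx1 up_upT invmx1 mul1mx.
Qed.

(** Every epimorphism is realized: a basis adapted to the kernel of its
    projection to [Z^r], the induced map on the kernel, and an automorphism of
    [A] that absorbs the torsion component on the complement. *)
Lemma realize_surj (f : {additive H -> A}) : epi f ->
  exists M g, [/\ M \in unitmx, epi g & equiv_epi f (realize M g)].
Proof.
move=> fe.
have [N NE] := additive_mx (pA \o f \o sH : {additive _ -> _}).
have pAf x : pA (f x) = N *m pH x.
  rewrite -NE [in LHS](torsH_split x) (raddfD f) (raddfD pA).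
  rewrite [X in _ + X](_ : _ = 0) ?addr0//.
  by apply/(projA_ker D)/torsion_additive; exact: (valP (torsH x)).
have /choice[S0 S0E] (j : 'I_r) : exists v : 'cV[int]_n, N *m v = delta_mx j 0.
  have [a aE] := projA_epi D (delta_mx j 0); have [x xa] := fe a.
  by exists (pH x); rewrite -pAf xa.
have NS : N *m (\matrix_(i, j) S0 j i 0) = 1%:M.
  apply/matrixP => i j; have /colP/(_ i) := S0E j.
  rewrite !mxE andbT => <-; apply: eq_bigr => l _; by rewrite mxE.
have [rn' [M Mu NM]] := surjection_normal_form NS.
rewrite (bool_irrelevance rn' rn) in NM.
have pAfE x : pA (f x) = low *m base M x by rewrite pAf -NM -mulmxA mulKVmx.
have [ka [kaK Kka]] := additive_inv (quoH_bij D).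
pose g0 (b : HmodA D) := qA (f (sH (M *m (up^T *m (ka b).1)) + val (ka b).2)).
have g0B : {morph g0 : b b' / b - b'}.
  move=> b b'.
  have k1 : (ka (b - b')).1 = (ka b).1 - (ka b').1 by rewrite raddfB.
  have k2 : val (ka (b - b')).2 = val (ka b).2 - val (ka b').2 by rewrite raddfB.
  by rewrite /g0 k1 k2 !mulmxBr (raddfB sH) addrACA -opprD (raddfB f) (raddfB qA).
pose g := additive_of g0B.
have gE v t : g (quoH D (v, t)) = qA (f (sH (M *m (up^T *m v)) + val t)).
  by rewrite /g /= /g0 kaK.
(* [c] is the torsion component of [f] on the complement of the kernel. *)
pose c (a : A) := tA (qA (f (sH (M *m (low^T *m pA a))))).
have cB : {morph c : z z' / z - z'}.
  move=> z z'; rewrite /c (raddfB pA) !mulmxBr (raddfB sH) (raddfB f).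
  by rewrite (raddfB qA) (raddfB tA).
have alB : {morph (fun z => z - c z) : z z' / z - z'}.
  by move=> z z'; rewrite cB opprD addrACA -opprD.
have pc z : pA (c z) = 0 by exact: pA_tA.
exists M, g; split=> //.
  move=> b; have [x xb] := fe (tA b).
  have low0 : low *m base M x = 0 by rewrite -pAfE xb pA_tA.
  exists (quoH D (up *m base M x, torsH x)); rewrite gE -(qA_tA b) -xb.
  congr (qA (f _)); rewrite [RHS]torsH_split; congr (sH _ + _).
  rewrite -[RHS](mulKVmx Mu) -/(base M x); congr (M *m _).
  by rewrite [RHS](low_split rn) low0 mulmx0 addr0.
exists (additive_of alB).
  apply: additive_bij => [z /= zc|z].
    have pz : pA z = 0 by have := congr1 pA zc; rewrite raddfB /= pc subr0 raddf0.
    have cz : c z = 0 by rewrite /c pz !mulmx0 !raddf0.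
    by move: zc; rewrite cz subr0.
  exists (z + c z) => /=.
  rewrite (_ : c (z + c z) = c z) ?addrK//.
  by rewrite /c raddfD /= pc addr0.
move=> x; apply: A_eq; rewrite /= ?(raddfB pA) ?(raddfB qA) /=.
  by rewrite pA_realize pc subr0 pAfE.
rewrite qA_realize gE /c qA_tA pAfE -raddfB -[f _ - _]raddfB; congr (qA (f _)).
apply/eqP; rewrite eq_sym subr_eq addrAC -raddfD -mulmxDr -(low_split rn (base M x)).
by rewrite mulKVmx// -torsH_split.
Qed.

End Realization.

(** * The bijection *)

Section TwistedBijection.
Variables (H A : zmodType) (n r : nat) (D : splitting H A n r) (rn : (r <= n)%N).
Local Notation realize := (realize (D := D) rn).

Lemma Gamma_epi_class (K B : zmodType) c : Gamma K B c <->
  exists2 f : {additive K -> B}, epi f & c = epi_class f.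
Proof. by split=> [[f fe <-]|[f fe ->]]; exists f. Qed.

(** The bijection sends the class of an epimorphism to the set of all data that
    realize it up to an automorphism of [A]. *)
Definition realizations (C : set {additive H -> A}) :
    set ('M[int]_n * set {additive HmodA D -> AmodA D}) :=
  [set x | (GLZ n `*` GammaT D) x /\ exists2 g, x.2 g & C (realize x.1 g)].

Lemma realizationsE f M g : GLZ n M -> epi g -> epi f -> equiv_epi f (realize M g) ->
  realizations (epi_class f) =
  [set y | (GLZ n `*` GammaT D) y /\ twist_rel (M, epi_class g) y].
Proof.
move=> Mu ge fe fM; apply/seteqP; split=> -[M' c'] [[M'u c'G] rest]; split=> //.
  have [g1 c'g1 [_ fM']] := rest; simpl in *.
  have [g' g'e c'E] := (iffLR (Gamma_epi_class c')) c'G.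
  move: c'g1; rewrite c'E => -[g1e g'g1].
  have [Q PQ [MQ cQ]] := act_realize Mu M'u ge g1e (equiv_epi_trans (equiv_epi_sym fM) fM').
  by exists Q => //; split=> //=; rewrite (epi_class_eq g'g1).
have [Q PQ [/= MQ cQ]] := rest; simpl in *.
have [g' g'e c'E] := (iffLR (Gamma_epi_class c')) c'G.
have g'c : c' g' by rewrite c'E; split=> //; exact: equiv_epi_refl.
exists g' => //=; split; first exact: realize_epi.
apply: (equiv_epi_trans fM); rewrite MQ.
by apply: realize_act => //; rewrite -cQ.
Qed.

Lemma twisted_bij : set_bij (Gamma H A) (twisted_product D) realizations.
Proof.
have refl f M g : GLZ n M -> epi g -> epi f -> equiv_epi f (realize M g) ->
    realizations (epi_class f) (M, epi_class g).
  move=> Mu ge fe fM; split.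
    by split=> //=; apply/Gamma_epi_class; exists g.
  by exists g; split=> //; [exact: equiv_epi_refl|exact: realize_epi].
split.
- move=> C /Gamma_epi_class[f fe ->]; have [M [g [Mu ge fM]]] := realize_surj D rn fe.
  rewrite (realizationsE Mu ge fe fM); exists (M, epi_class g) => //.
  by split=> //=; apply/Gamma_epi_class; exists g.
- move=> C C' /set_mem/Gamma_epi_class[f fe ->] /set_mem/Gamma_epi_class[f' f'e ->] E.
  have [M [g [Mu ge fM]]] := realize_surj D rn fe.
  have := refl _ _ _ Mu ge fe fM; rewrite E => -[_ [g1 [/= g1e gg1] [_ f'M]]].
  apply: epi_class_eq; apply: (equiv_epi_trans fM); apply: equiv_epi_sym.
  apply: (equiv_epi_trans f'M); apply: equiv_epi_sym.
  rewrite -{1}[M]mulmx1; apply: realize_act => //; first exact: (parabolic1 rn).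
  by apply: act1 => //; split.
- move=> _ [[M c] [Mu /Gamma_epi_class[g ge /= ->]] <-].
  have fe := realize_epi rn Mu ge.
  exists (epi_class (realize M g)); first by apply/Gamma_epi_class; exists (realize M g).
  by rewrite (realizationsE Mu ge fe (equiv_epi_refl _)).
Qed.

Lemma GammaT_finite : fg H -> fg A -> finite_set (GammaT D).
Proof.
move=> Hfg Afg; apply: finite_image; apply: (@sub_finite_set _ _ setT) => //.
apply: finite_hom; first exact: (fg_epi (@quotmap_epi _ _) Hfg).
apply: finite_torsion_group; first exact: (fg_epi (@quotmap_epi _ _) Afg).
by move=> b; rewrite -[b]qA_tA; apply: torsion_additive; exact: tA_torsion.
Qed.

End TwistedBijection.

Section SplittingExists.
Variables (H A : zmodType) (q : {additive H -> A}) (q_epi : epi q).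
Variables (n r : nat).
Variables (pH : {additive H -> 'cV[int]_n}) (sH : {additive 'cV[int]_n -> H}).
Hypotheses (sHK : cancel sH pH) (pHT : forall x, pH x = 0 <-> x \in torsion H).
Variables (pA : {additive A -> 'cV[int]_r}) (sA : {additive 'cV[int]_r -> A}).
Hypotheses (sAK : cancel sA pA) (pAT : forall x, pA x = 0 <-> x \in torsion A).

(** With [N] the matrix of the map from [Z^n] to [Z^r] and [S] a section of it, [sec]
    is given by [S], and the first [n - r] members of a basis adapted to the kernel of
    [N] give the free part of [quoH]. *)
Lemma splitting_exists : inhabited (splitting H A n r) /\ (r <= n)%N.
Proof.
pose ep : {additive H -> 'cV[int]_r} := (pA \o q : {additive _ -> _}).
have epe : epi ep.
  by move=> w; have [x xw] := q_epi (sA w); exists x; rewrite /ep /= xw sAK.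
have [N NE] := additive_mx (ep \o sH : {additive _ -> _}).
have epE x : ep x = N *m pH x.
  rewrite -NE /=; apply/eqP; rewrite -subr_eq0 -!raddfB; apply/eqP/pAT.
  apply: torsion_additive; apply/pHT.
  by rewrite raddfB sHK subrr.
have /choice[S0 S0E] (j : 'I_r) : exists v : 'cV[int]_n, N *m v = delta_mx j 0.
  by have [x xa] := epe (delta_mx j 0); exists (pH x); rewrite -epE.
pose S := \matrix_(i, j) S0 j i 0.
have NS : N *m S = 1%:M.
  apply/matrixP => i j; have /colP/(_ i) := S0E j.
  rewrite !mxE andbT => <-; apply: eq_bigr => l _; by rewrite mxE.
have [rn [M Mu NM]] := surjection_normal_form NS; split=> //.
pose sec0 : {additive 'cV[int]_r -> H} := (sH \o mulmx S : {additive _ -> _}).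
pose quo0 (w : 'cV[int]_(n - r) * Tors H) : quotgrp (im_pred sec0) :=
  quotmap (im_pred sec0) (sH (M *m ((up n r)^T *m w.1)) + val w.2).
have quo0B : {morph quo0 : w w' / w - w'}.
  move=> w w'; rewrite /quo0 -raddfB; congr (quotmap _ _).
  by rewrite /= !mulmxBr (raddfB sH) opprD addrACA.
have NMup v : N *m (M *m ((up n r)^T *m v)) = 0.
  by rewrite !mulmxA NM low_upT mul0mx.
have pHval (t : Tors H) : pH (val t) = 0 by apply/pHT; exact: (valP t).
have quo0_bij : bijective (additive_of quo0B).
  apply: additive_bij => [[v t] /quotmap_eq0|b].
    rewrite unfold_in => /asboolP[w /= wE].
    have := congr1 pH wE; rewrite sHK raddfD /= sHK pHval addr0 => SvE.
    have w0 : w = 0 by rewrite -[w]mul1mx -NS -mulmxA SvE NMup.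
    have v0 : v = 0.
      move: SvE; rewrite w0 mulmx0 => /esym/(congr1 (mulmx (invmx M))).
      rewrite mulKmx// mulmx0 => /(congr1 (mulmx (up n r))).
      by rewrite mulmxA up_upT mul1mx mulmx0.
    congr pair => //; apply: val_inj => /=.
    by move: wE; rewrite v0 w0 !mulmx0 raddf0 add0r.
  have [x <-] := quotmap_epi b.
  pose y := pH x - S *m (N *m pH x).
  have Ny : N *m y = 0 by rewrite mulmxBr (mulmxA N S) NS mul1mx subrr.
  have xT : x - sH (pH x) \in torsion H by apply/pHT; rewrite raddfB sHK subrr.
  pose t : Tors H := exist _ (x - sH (pH x)) xT.
  exists (up n r *m (invmx M *m y), t); rewrite /= /quo0.
  apply/eqP; rewrite -subr_eq0 -raddfB; apply/eqP/quotmap_eq0.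
  rewrite unfold_in; apply/asboolP; exists (- (N *m pH x)).
  have -> : M *m ((up n r)^T *m (up n r *m (invmx M *m y))) = y.
    rewrite -[RHS](mulKVmx Mu); congr (M *m _).
    rewrite [RHS](low_split rn) (_ : low rn *m _ = 0) ?mulmx0 ?addr0//.
    by rewrite -NM -mulmxA mulKVmx.
  rewrite /= mulmxN raddfN /y (raddfB sH) [X in X - x]addrC.
  by rewrite addrA subrK addrAC subrr add0r.
refine (inhabits (@Splitting H A n r pH sH pA sA ep sec0 (additive_of quo0B)
  _ pHT sHK _ pAT sAK epe _ _ quo0_bij _ _)).
- by move=> v; exists (sH v); rewrite sHK.
- by move=> v; exists (sA v); rewrite sAK.
- by move=> w; rewrite epE /= sHK mulmxA NS mul1mx.
- by move=> v; exists (S *m v).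
- by move=> t; rewrite /= /quo0 /= !mulmx0 raddf0 add0r.
- by move=> v; exists (M *m ((up n r)^T *m v)); rewrite /= /quo0 /= addr0.
Qed.

End SplittingExists.

Theorem theorem1 (R : realType) (X : topologicalType) (W : cw_complex R X)
    (X_connected : connected [set: X]) (X_finite : finite_1skeleton W)
    (A : zmodType) (q : {additive H1 R X -> A}) (q_epi : epi q)
    (n r : nat) (hn : n = rank (H1 R X)) (hr : r = rank A) :
  [/\ inhabited (splitting (H1 R X) A n r),
      exists2 F : set 'M[int]_n -> set 'cV[int]_n,
        set_bij (GL_mod_parabolic n r) (Gr (n - r)%N n) F &
        forall M, GLZ n M ->
          F [set M *m Q | Q in parabolic n r] =
          [set M *m v | v in std_summand n r] &
      forall D : splitting (H1 R X) A n r,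
        finite_set (GammaT D) /\
        exists F, set_bij (Gamma (H1 R X) A) (twisted_product D) F].
Proof.
have Hfg := H1_fg X_finite.
have Afg := fg_epi q_epi Hfg.
have [n' [pH [sH [sHK pHT]]]] := fg_split Hfg.
have [r' [pA [sA [sAK pAT]]]] := fg_split Afg.
have nE : n = n' by rewrite hn (rank_split sHK pHT).
have rE : r = r' by rewrite hr (rank_split sAK pAT).
subst n' r'.
have [spl rn] := splitting_exists q_epi sHK pHT sAK pAT.
split=> //.
  exists (@coset_summand n r); first exact: coset_summand_bij.
  by move=> M _; exact: coset_summandE.
move=> D; split; first exact: GammaT_finite.
by exists (@realizations _ _ _ _ D rn); exact: twisted_bij.
Qed.
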